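(* Let $\Omega\subset\mathbb{R}^2$ be a bounded open set that is convex and balanced. Then $$\kappa(\Omega)\le \tilde C\,\kappa(\Omega^* ),\qquad \tilde C:=\frac{2j_{0,1}}{j_{1,1}}\approx 1.2552 .$$
   Context: $\Omega$ is balanced if it is invariant under $\mathbf{x}\mapsto-\mathbf{x}$. For a bounded open $\Omega\subset\mathbb{R}^d$ let $\widehat{\chi_\Omega}(\boldsymbol{\xi})=\int_\Omega e^{i\boldsymbol{\xi}\cdot\mathbf{x}}\,d\mathbf{x}$, and let $\mathcal{N}(\Omega)=\{\boldsymbol{\xi}\in\mathbb{R}^d:\widehat{\chi_\Omega}(\boldsymbol{\xi})=0\}$ be its real null set. Set $\kappa(\Omega)=\min\{|\boldsymbol{\xi}|:\boldsymbol{\xi}\in\mathcal{N}(\Omega)\}$, with $\kappa(\Omega)=\infty$ if $\mathcal{N}(\Omega)=\emptyset$. $\Omega^*$ is the ball centred at the origin of the same volume as $\Omega$. $j_{a,k}$ is the $k$-th positive zero of the Bessel function $J_a$. *)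

(* Defs.v *)
From mathcomp Require Import all_boot all_order all_algebra.
From mathcomp Require Import all_classical all_reals all_analysis.
From mathcomp Require Import complex.

Set Implicit Arguments.
Unset Strict Implicit.
Unset Printing Implicit Defensive.

Import Order.TTheory GRing.Theory Num.Theory.
Import numFieldNormedType.Exports.
Local Open Scope classical_set_scope.
Local Open Scope ring_scope.
Local Open Scope complex_scope.

Section Plane.
Context {R : realType}.
Implicit Types (A : set (R * R)) (x xi : R * R).

(* The norm that MathComp-Analysis puts on [R * R] is the sup norm; it is only
   used for openness and boundedness. Lengths of vectors are [enorm]. *)
Definition dotp xi x : R := xi.1 * x.1 + xi.2 * x.2.

Definition enorm x : R := Num.sqrt (dotp x x).

Definition area :
    {measure set (measurableTypeR R * measurableTypeR R) -> \bar R} :=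
  (@lebesgue_measure R \x @lebesgue_measure R)%E.

Definition disk (r : R) : set (R * R) := [set x | enorm x < r].

Definition balanced A := forall x, A x -> A (- x).

(* [R^o] carries the vector space structure used by [convex_set]. *)
Definition convex A := convex_set (A : set (R^o * R^o)%type).

(* Integral over [A] of exp(i <xi, x>) = cos <xi, x> + i sin <xi, x>,
   taken componentwise. *)
Definition fourier_ind A xi : R[i] :=
  (\int[area]_(x in A) cos (dotp xi x)) +i*
  (\int[area]_(x in A) sin (dotp xi x)).

Definition real_null_set A : set (R * R) := [set xi | fourier_ind A xi = 0].

(* The infimum over the empty set is [+oo]. For bounded [A], [fourier_ind A] is
   continuous, so [real_null_set A] is closed, and if it is nonempty the infimum is
   a minimum. *)
Definition kappa A : \bar R :=
  ereal_inf [set (enorm xi)%:E | xi in real_null_set A].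

(* If [area A = 0] the radius is some [r <= 0] and the disk is empty. *)
Definition symm_disk A : set (R * R) :=
  disk (get [set r | area (disk r) = area A]).

End Plane.

Section Bessel.
Context {R : realType}.

(* Bessel function of the first kind, of integer order [n]. *)
Definition besselJ (n : nat) (x : R) : R :=
  limn (series (fun m : nat =>
    (-1) ^+ m / (m`! * (m + n)`!)%:R * (x / 2) ^+ (2 * m + n))).

(* [bessel_zero n k] is the [k]-th positive zero j_{n,k}, counted from
   [k = 1]; the value 0 at [k = 0] only starts the recursion. The zeros are
   isolated, so each infimum is the next zero. *)
Fixpoint bessel_zero (n k : nat) : R :=
  if k is k'.+1 then
    inf [set x | bessel_zero n k' < x /\ besselJ n x = 0]
  else 0.

End Bessel.

(* Main.v *)
(* Normalize so that the ball of the same area has radius r; its transform has no zero of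
   modulus less than 3.81 / r. Take q = 4.78 / r, which is below C * 3.81 / r. It suffices
   to find xi with |xi| <= q at which the transform of Omega, real by symmetry, is
   nonpositive, since it is positive at 0.
   If Omega contains a point x0 with q * |x0| >= 2 * pi, let h >= |x0| be the half-width
   of Omega in the direction of x0. The section length in that direction is even and
   concave; comparing it with the chord through the abscissas h / 4 and 3 * h / 4, between
   which cos (2 * pi * t / h) is negative, shows that xi of modulus 2 * pi / h works.
   Otherwise Omega lies in the disk q * |x| < 2 * pi. If the transform were positive on
   the circle |xi| = q, its average, the integral of J_0 (q * |x|) over Omega, would be
   nonnegative. Along the ray to a boundary point of modulus s this integral is
   s * J_1 (q * s) / q, at most an affine decreasing function of s ^ 2 on this range;
   integrating over the rays bounds it by a negative multiple of the difference of areas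
   between Omega and a smaller disk. All numerical facts about J_0 and J_1 come from
   partial sums of their alternating series. *)
Require Import Defs.
From HB Require Import structures.
From mathcomp Require Import all_boot all_order all_algebra.
From mathcomp Require Import all_classical all_reals all_analysis.
From mathcomp Require Import measurable_realfun.
From mathcomp Require Import ring lra.
Set Implicit Arguments.
Unset Strict Implicit.
Unset Printing Implicit Defensive.
Import Order.TTheory GRing.Theory Num.Theory.
Import numFieldNormedType.Exports.
Local Open Scope classical_set_scope.
Local Open Scope ring_scope.

(** The two cases meet at 2 * pi for a reason on each side. A half-width h of at least 2 * pi / q is
    exactly what makes the frequency 2 * pi / h admissible. The affine majorant of s * J_1 (q * s) /
    q, in turn, survives only slightly past q * s = 2 * pi: the function turns upwards at q * s =
    5.52, the second zero of J_0, while the line keeps falling. In the integrals, Bessel functions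
    occur only as polynomials. The cosine is first bounded by a Taylor polynomial, whose even powers
    have explicit averages over a circle (Wallis products); the average is then a polynomial in |x|
    ^ 2 with an explicit primitive along each ray, and every estimate becomes positivity of a
    rational polynomial on an interval. The transform of a disk is radial, hence equal to its own
    average, so the same averaging lemma, applied to minus the cosine, yields the bound 3.81 / r.
    The constants have slack: 4.78 < 2 * j_{0,1} = 4.8097, 3.81 < j_{1,1} = 3.8317, and C * 3.81 >
    4.78 holds already with 1.2551 in place of C. *)

(** * Taylor bounds for sine and cosine, and an upper bound for pi *)

Section Taylor.
Context {R : realType}.
Implicit Types w x y : R.

Lemma nonneg_of_derive (f df : R -> R) w :
  (forall x, is_derive x 1 f (df x)) -> f 0 = 0 ->
  (forall x, 0 <= x -> 0 <= df x) -> 0 <= w -> 0 <= f w.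
Proof.
move=> fdf f0 df0; rewrite le_eqVlt => /predU1P[<-|w0]; first by rewrite f0.
have [|c + e] := @MVT R f df 0 w w0 (fun x _ => fdf x).
  apply: continuous_subspaceT => x.
  by apply/differentiable_continuous/derivable1_diffP; case: (fdf x).
rewrite in_itv/= => /andP[/ltW c0 _].
by have := e; rewrite f0 !subr0 => ->; rewrite mulr_ge0// ?df0// ltW.
Qed.

Lemma continuous_cos_scaled (a : R) : continuous (fun x : R => cos (a * x)).
Proof.
move=> x; apply: (@continuous_comp _ _ _ ( *%R a) cos); last exact: continuous_cos.
exact: mulrl_continuous.
Qed.

Definition cos_taylor n : {poly R} := \sum_(k < n) ((-1) ^+ k / (2 * k)`!%:R) *: 'X^(2 * k).
Definition sin_taylor n : {poly R} := \sum_(k < n) ((-1) ^+ k / (2 * k).+1`!%:R) *: 'X^((2 * k).+1).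

Lemma fact_neq0 n : n`!%:R != 0 :> R.
Proof. by rewrite pnatr_eq0 -lt0n fact_gt0. Qed.

Lemma deriv_sin_taylor n : (sin_taylor n)^`() = cos_taylor n.
Proof.
rewrite raddf_sum; apply: eq_bigr => k _.
rewrite /= derivZ derivXn -scalerMnr scalerMnl; congr (_ *: _).
by rewrite -mulr_natr factS natrM invfM mulrCA mulrC mulVKf// pnatr_eq0.
Qed.

Lemma deriv_cos_taylor n : (cos_taylor n.+1)^`() = - sin_taylor n.
Proof.
rewrite /cos_taylor big_ord_recl/= muln0 expr0 alg_polyC derivD derivC add0r raddf_sum -sumrN.
apply: eq_bigr => k _.
rewrite /= derivZ derivXn -scalerMnr scalerMnl -scaleNr.
rewrite (_ : (2 * bump 0 k)%N = (2 * k).+2) /bump; last by rewrite leq0n add1n mulnS.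
congr (_ *: _); rewrite -mulr_natr factS natrM invfM/= add1n.
by rewrite mulrCA mulrC mulVKf ?pnatr_eq0// exprS mulN1r mulNr.
Qed.

Lemma horner_taylor0 n : (cos_taylor n.+1).[0] = 1 /\ (sin_taylor n).[0] = 0.
Proof.
split.
  rewrite /cos_taylor big_ord_recl/= muln0 expr0 hornerD hornerZ hornerC horner_sum.
  rewrite fact0 divr1 mul1r big1 ?addr0// => k _.
  by rewrite hornerZ hornerXn expr0n muln_eq0 /bump leq0n mulr0.
by rewrite /sin_taylor horner_sum big1// => k _; rewrite hornerZ hornerXn exprS mul0r mulr0.
Qed.

(** Sine and cosine go together: the cosine remainder is the derivative of the sine remainder of the
    same order, and minus the sine remainder is the derivative of the next cosine remainder, whence
    the alternating sign. *)
Lemma taylor_alternate n w : 0 <= w ->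
  0 <= (-1) ^+ n.+1 * (cos w - (cos_taylor n.+1).[w]) /\
  0 <= (-1) ^+ n.+1 * (sin w - (sin_taylor n.+1).[w]).
Proof.
have H m : (forall w, 0 <= w -> 0 <= (-1) ^+ m.+1 * (cos w - (cos_taylor m.+1).[w])) ->
    forall w, 0 <= w -> 0 <= (-1) ^+ m.+1 * (sin w - (sin_taylor m.+1).[w]).
  move=> ih v; apply: (@nonneg_of_derive (fun w => (-1) ^+ m.+1 * (sin w - (sin_taylor m.+1).[w]))
    (fun w => (-1) ^+ m.+1 * (cos w - (cos_taylor m.+1).[w])) v) => //.
    move=> x; have := @is_derive_poly R (sin_taylor m.+1) x; rewrite deriv_sin_taylor => ?.
    by apply: is_deriveZ.
  by rewrite sin0 (horner_taylor0 m.+1).2 subrr mulr0.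
elim: n w => [|n ih] w w0.
  have c1 v : 0 <= v -> 0 <= (-1) ^+ 1 * (cos v - (cos_taylor 1).[v]).
    rewrite /cos_taylor big_ord1 /= muln0 expr0 hornerZ hornerC fact0 expr1.
    by have := cos_le1 v; lra.
  by split; [exact: c1|exact: H].
have c1 v : 0 <= v -> 0 <= (-1) ^+ n.+2 * (cos v - (cos_taylor n.+2).[v]).
  apply: (@nonneg_of_derive (fun w => (-1) ^+ n.+2 * (cos w - (cos_taylor n.+2).[w]))
    (fun w => (-1) ^+ n.+1 * (sin w - (sin_taylor n.+1).[w])) v).
  - move=> x; have := @is_derive_poly R (cos_taylor n.+2) x.
    rewrite deriv_cos_taylor hornerN => D.
    have -> : (-1) ^+ n.+1 * (sin x - (sin_taylor n.+1).[x]) =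
       (-1) ^+ n.+2 *: (- sin x - - (sin_taylor n.+1).[x]).
      by rewrite -[RHS]/(_ * _) [in RHS]exprS mulN1r mulNr -mulrN opprB opprK addrC.
    exact: is_deriveZ.
  - by rewrite cos0 (horner_taylor0 n.+1).1 subrr mulr0.
  - by move=> x /ih[].
by split; [exact: c1|exact: H].
Qed.

Lemma cos_taylorN n w : (cos_taylor n).[- w] = (cos_taylor n).[w].
Proof.
rewrite !horner_sum; apply: eq_bigr => k _.
by rewrite !hornerZ !hornerXn exprM sqrrN -exprM.
Qed.

Lemma cos_alternate n w : 0 <= (-1) ^+ n.+1 * (cos w - (cos_taylor n.+1).[w]).
Proof.
have [w0|w0] := leP 0 w; first by have [] := taylor_alternate n w0.
by rewrite -cosN -cos_taylorN; have [] := @taylor_alternate n (- w); rewrite // oppr_ge0 ltW.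
Qed.

(** Five Taylor terms show that the cosine is negative at 11 / 7, whereas it is nonnegative up to pi
    / 2. *)
Lemma pi_lt22_7 : pi < 22 / 7 :> R.
Proof.
rewrite ltNge; apply/negP => le_pi.
have : 0 <= cos (11 / 7 : R) by apply: cos_ge0_pihalf; apply/andP; lra.
have := cos_alternate 4 (11 / 7); rewrite -signr_odd/= expr1.
rewrite /cos_taylor !big_ord_recr big_ord0/= add0r !hornerD !hornerZ !hornerXn.
rewrite -[(2 * 4)%N]/8%N -[(2 * 3)%N]/6%N -[(2 * 2)%N]/4%N muln0 muln1 !factS fact0 !natrM.
lra.
Qed.

End Taylor.

(** Past index [N] the terms group into consecutive pairs, each of sign [(-1) ^+ N]; the limit is
    taken along the partial sums that contain whole pairs. *)
Lemma alternating_series_bound (R : realType) (a : R ^nat) (N : nat) :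
  (forall m, (N <= m)%N -> a m.+1 <= a m) ->
  cvgn (series (fun m => (-1) ^+ m * a m)) ->
  0 <= (-1) ^+ N * (limn (series (fun m => (-1) ^+ m * a m)) - \sum_(m < N) (-1) ^+ m * a m).
Proof.
move=> a_dec; set u := fun m => _; move=> cvg_u.
have pairs M : 0 <= (-1) ^+ N * (series u (M.*2 + N)%N - \sum_(m < N) (-1) ^+ m * a m).
  elim: M => [|M ih]; first by rewrite /series/= big_mkord subrr mulr0.
  rewrite doubleS !addSn /series/= !big_nat_recr//= -addrA -addrA addrC -addrA.
  rewrite mulrDr addr_ge0//; last by rewrite addrC.
  have -> : u (M.*2 + N)%N + u (M.*2 + N).+1 =
      (-1) ^+ N * (a (M.*2 + N)%N - a (M.*2 + N).+1).
    by rewrite /u exprS exprD -mul2n exprM sqrrN !expr1n; ring.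
  rewrite mulrA -exprD addnn -mul2n exprM sqrrN !expr1n mul1r subr_ge0.
  by rewrite a_dec// leq_addl.
have sub_cvg : series u (M.*2 + N)%N @[M --> \oo] --> limn (series u).
  apply: cvg_comp cvg_u => A [n _ nA]; exists n => // M /= nM; apply: nA => /=.
  by rewrite (leq_trans nM)// -addnn -addnA leq_addr.
have lim_sub : (-1) ^+ N * (series u (M.*2 + N)%N - \sum_(m < N) (-1) ^+ m * a m) @[M --> \oo]
    --> (-1) ^+ N * (limn (series u) - \sum_(m < N) (-1) ^+ m * a m).
  by apply: cvgMr; apply: cvgB => //; exact: cvg_cst.
rewrite -(cvg_lim _ lim_sub)//; apply: limr_ge; first by apply/cvg_ex; eexists; exact: lim_sub.
by near=> M; exact: pairs.
Unshelve. all: by end_near. Qed.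

(** * Bessel power series and the location of the first positive zero *)

Section Bessel.
Context {R : realType}.
Implicit Types (c : R ^nat) (x v K : R).

Lemma cvg_pseries_inv_fact c K :
  (forall m, `|c m| <= m`!%:R^-1) -> cvgn (pseries c K).
Proof.
move=> c_le; apply: normed_cvg; rewrite /=.
apply: (@series_le_cvg _ _ (exp_coeff `|K|)).
- by move=> m /=; rewrite normr_ge0.
- by move=> m; rewrite exp_coeff_ge0.
- move=> m /=; rewrite normrM normrX /exp_coeff/= mulrC.
  by rewrite ler_wpM2l// exprn_ge0.
- exact: is_cvg_series_exp_coeff.
Qed.

(** The bound by inverse factorials survives termwise differentiation, so it also covers the two
    derived series that [pseries_snd_diffs] asks for. *)
Lemma pseries_diffs_inv_fact_le c :
  (forall m, `|c m| <= m`!%:R^-1) -> forall m, `|pseries_diffs c m| <= m`!%:R^-1.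
Proof.
move=> c_le m; rewrite /pseries_diffs normrM ger0_norm//.
by rewrite (le_trans (ler_wpM2l _ (c_le _)))// factS natrM invfM mulVKf.
Qed.

Definition bessel_coeff n m : R := (-1) ^+ m / (m`! * (m + n)`!)%:R.

Lemma bessel_coeff0 n : bessel_coeff n 0 = n`!%:R^-1.
Proof. by rewrite /bessel_coeff expr0 fact0 mul1n add0n mul1r. Qed.

Lemma bessel_coeffS n m :
  bessel_coeff n m.+1 = - bessel_coeff n m / m.+1%:R / (m.+1 + n)%:R.
Proof.
by rewrite /bessel_coeff exprS mulN1r addSn !factS !natrM !invfM; ring.
Qed.

Lemma bessel_coeff_le n m : `|bessel_coeff n m| <= m`!%:R^-1.
Proof.
rewrite normrM normrX normrN1 expr1n mul1r normfV ger0_norm// lef_pV2 ?posrE ?ltr0n ?muln_gt0 ?fact_gt0//.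
by rewrite ler_nat leq_pmulr// fact_gt0.
Qed.

(** J_n without its factor [(x / 2) ^+ n], in the variable [v = (x / 2) ^+ 2]: the positive zeros
    correspond, and partial sums have half the degree. *)
Definition bessel_entire n v : R := limn (pseries (bessel_coeff n) v).

Lemma besselJE n x : besselJ n x = (x / 2) ^+ n * bessel_entire n ((x / 2) ^+ 2).
Proof.
rewrite /besselJ /bessel_entire.
rewrite -[RHS]/((x / 2) ^+ n *: _) -limZr; last first.
  by apply: cvg_pseries_inv_fact => m; exact: bessel_coeff_le.
congr (limn _); apply/funext => k.
rewrite -[RHS]/(_ * \sum_(0 <= i < k) _) mulr_sumr; apply: eq_bigr => m _.
by rewrite /= exprD exprM mulrA mulrC.
Qed.

Lemma continuous_bessel_entire n : continuous (bessel_entire n).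
Proof.
move=> v; have le0 := bessel_coeff_le n.
have le1 := pseries_diffs_inv_fact_le le0; have le2 := pseries_diffs_inv_fact_le le1.
have vK : `|v| < `| `|v| + 1|.
  by rewrite [ltRHS]ger0_norm ?ltrDl// addr_ge0.
have cK c le := @cvg_pseries_inv_fact c (`|v| + 1) le.
have := pseries_snd_diffs (cK _ le0) (cK _ le1) (cK _ le2) vK.
by case=> D _; apply/differentiable_continuous/derivable1_diffP.
Qed.

Lemma bessel_entire_alternate n N v : (0 < N)%N -> 0 <= v <= 4 ->
  0 <= (-1) ^+ N * (bessel_entire n v - \sum_(m < N) bessel_coeff n m * v ^+ m).
Proof.
move=> N0 /andP[v0 v4].
pose a m : R := v ^+ m / (m`! * (m + n)`!)%:R.
have uE : (fun m => bessel_coeff n m * v ^+ m) = (fun m => (-1) ^+ m * a m).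
  by apply/funext => m; rewrite /bessel_coeff /a mulrAC mulrA.
rewrite /bessel_entire /pseries.
under eq_bigr do rewrite (congr1 (@^~ _) uE).
rewrite uE; apply: alternating_series_bound; last first.
  by rewrite -uE; apply: cvg_pseries_inv_fact; exact: bessel_coeff_le.
move=> m Nm; rewrite /a addSn !factS !natrM !invfM exprS.
have -> : v * v ^+ m * (m.+1%:R^-1 * m`!%:R^-1 * ((m + n).+1%:R^-1 * (m + n)`!%:R^-1)) =
   (v / (m.+1%:R * (m + n).+1%:R)) * (v ^+ m * (m`!%:R^-1 * (m + n)`!%:R^-1)).
  by rewrite invfM; ring.
(* The ratio of consecutive terms is at most 4 / (2 * 2), because [m >= N >= 1]. *)
rewrite ler_piMl ?mulr_ge0 ?exprn_ge0 ?invr_ge0//.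
rewrite ler_pdivrMr ?mul1r ?mulr_gt0// (le_trans v4)// -natrM ler_nat.
have m2 : (1 < m.+1)%N by exact: leq_trans N0 Nm.
by rewrite (@leq_mul 2 2)// (leq_trans m2)// ltnS leq_addr.
Qed.

(** Positivity up to [a] excludes zeros below [l]; the negative value at [b] and the intermediate
    value theorem give a zero between [l] and [2 * sqrt b <= u]. Working with [a] and [b] in the
    variable [v] allows fractions with small denominators. *)
Lemma first_zero_bounds n (l u a b : R) : 0 < l -> 0 < u ->
  (l / 2) ^+ 2 <= a < b -> b <= (u / 2) ^+ 2 ->
  (forall v, 0 <= v <= a -> 0 < bessel_entire n v) -> bessel_entire n b < 0 ->
  l <= bessel_zero n 1 <= u.
Proof.
move=> l0 u0 /andP[la ab] bu pos neg; rewrite /bessel_zero/=; set Z := [set x | _].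
have {}pos v : 0 <= v <= (l / 2) ^+ 2 -> 0 < bessel_entire n v.
  by move=> /andP[v0 vl]; apply: pos; rewrite v0 (le_trans vl).
have b0 : 0 <= b by rewrite (le_trans (sqr_ge0 (l / 2)))// (le_trans la)// ltW.
pose w := 2 * Num.sqrt b; have wE : (w / 2) ^+ 2 = b by rewrite /w mulrC mulKf// sqr_sqrtr.
have le_sqr x y : 0 <= x -> 0 <= y -> (x / 2) ^+ 2 <= (y / 2) ^+ 2 -> x <= y.
  by move=> x0 y0; rewrite ler_sqr ?nnegrE ?divr_ge0// ler_pM2r.
have w0 : 0 <= w by rewrite mulr_ge0 ?sqrtr_ge0.
have lw : l <= w by apply: le_sqr => //; [exact: ltW|rewrite wE (le_trans la)// ltW].
have wu : w <= u by apply: le_sqr => //; [exact: ltW|rewrite wE].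
have Zl : lbound Z l.
  move=> x [x0]; rewrite besselJE => /eqP; rewrite mulf_eq0 expf_eq0 gt_eqF ?divr_gt0// andbF/=.
  apply: contraTT; rewrite -ltNge => xl; rewrite gt_eqF// pos// sqr_ge0/=.
  by rewrite ler_sqr ?nnegrE ?divr_ge0// ?ler_pM2r// ltW.
have [c] : exists2 c, c \in `[l, w] & bessel_entire n ((c / 2) ^+ 2) = 0.
  apply: (@IVT R (fun x => bessel_entire n ((x / 2) ^+ 2))) => //.
    apply: continuous_subspaceT => x.
    apply: (@continuous_comp _ _ _ ((fun y : R => y ^+ 2) \o ( *%R^~ 2^-1))); last first.
      exact: continuous_bessel_entire.
    by apply: continuous_comp; [exact: mulrr_continuous|exact: exprn_continuous].
  have p : 0 < bessel_entire n ((l / 2) ^+ 2) by apply: pos; rewrite sqr_ge0 lexx.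
  by rewrite wE ge_min le_max (ltW neg) (ltW p) orbT.
rewrite in_itv/= => /andP[lc cw] c0.
have Zc : Z c by split; [exact: lt_le_trans lc|rewrite besselJE c0 mulr0].
apply/andP; split; first by apply: lb_le_inf => //; exists c.
by apply: le_trans wu; apply: le_trans cw; apply: ge_inf => //; exists l.
Qed.

End Bessel.

(* On [a, b] the Bernstein basis polynomials are nonnegative; a polynomial with
   positive Bernstein coefficients is recognized by [lra] as positive there. *)
Lemma bernstein_ge0 (R : realFieldType) (a b v : R) (i j : nat) :
  a <= v <= b -> 0 <= (v - a) ^+ i * (b - v) ^+ j.
Proof.
by move=> /andP[av vb]; rewrite mulr_ge0// exprn_ge0// subr_ge0.
Qed.

(** * Decimal enclosures of the first zeros of J_0 and J_1 *)

Lemma bessel_zero0_bounds (R : realType) :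
  24 / 10 + 48 / 10 ^+ 4 <= (bessel_zero 0 1 : R) <= 24 / 10 + 485 / 10 ^+ 5.
Proof.
(* The two fractions enclose (j_{0,1} / 2) ^ 2 = 1.445796. An even number of terms bounds the series
   from below, an odd number from above. *)
apply: (@first_zero_bounds R 0 _ _ (120 / 83) (467 / 323)); try lra.
- move=> v vV.
  have v4 : 0 <= v <= 4 by move: vV => /andP[]; lra.
  have := @bessel_entire_alternate R 0 8 v isT v4.
  rewrite !big_ord_recr big_ord0/= !bessel_coeffS bessel_coeff0 fact0 !addn0.
  have B i j : 0 <= (83 * v - 0) ^+ i * (120 - 83 * v) ^+ j.
    by apply: bernstein_ge0; move: vV => /andP[? ?]; apply/andP; lra.
  have := B 0%N 7%N; have := B 1%N 6%N; have := B 2%N 5%N; have := B 3%N 4%N.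
  have := B 4%N 3%N; have := B 5%N 2%N; have := B 6%N 1%N; have := B 7%N 0%N.
  clear B vV v4; rewrite !expr0; lra.
- have v4 : 0 <= (467 / 323 : R) <= 4 by apply/andP; lra.
  have := @bessel_entire_alternate R 0 7 _ isT v4.
  rewrite !big_ord_recr big_ord0/= !bessel_coeffS bessel_coeff0 fact0 !addn0.
  clear v4; lra.
Qed.

Lemma bessel_zero1_bounds (R : realType) :
  38 / 10 + 3168 / 10 ^+ 5 <= (bessel_zero 1 1 : R) <= 38 / 10 + 318 / 10 ^+ 4.
Proof.
(* The two fractions enclose (j_{1,1} / 2) ^ 2 = 3.67049. *)
apply: (@first_zero_bounds R 1 _ _ (323 / 88) (312 / 85)); try lra.
- move=> v vV.
  have v4 : 0 <= v <= 4 by move: vV => /andP[]; lra.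
  have := @bessel_entire_alternate R 1 8 v isT v4.
  rewrite !big_ord_recr big_ord0/= !bessel_coeffS bessel_coeff0 (_ : 1`! = 1%N)// !addn1.
  have B i j : 0 <= (88 * v - 0) ^+ i * (323 - 88 * v) ^+ j.
    by apply: bernstein_ge0; move: vV => /andP[? ?]; apply/andP; lra.
  have := B 0%N 7%N; have := B 1%N 6%N; have := B 2%N 5%N; have := B 3%N 4%N.
  have := B 4%N 3%N; have := B 5%N 2%N; have := B 6%N 1%N; have := B 7%N 0%N.
  clear B vV v4; rewrite !expr0; lra.
- have v4 : 0 <= (312 / 85 : R) <= 4 by apply/andP; lra.
  have := @bessel_entire_alternate R 1 9 _ isT v4.
  rewrite !big_ord_recr big_ord0/= !bessel_coeffS bessel_coeff0 (_ : 1`! = 1%N)// !addn1.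
  clear v4; lra.
Qed.

(** The ratio is about 1.255224, only 0.00003 below the end 1.25525 of the allowed interval; this
    dictates the accuracy of the two enclosures. *)
Lemma bessel_zero_ratio_bounds (R : realType) :
  `|2 * bessel_zero 0 1 / bessel_zero 1 1 - (1 + 2552 / 10 ^+ 4)| < 1 / (2 * 10 ^+ 4) :> R.
Proof.
have /andP[a0 b0] := bessel_zero0_bounds R; have /andP[a1 b1] := bessel_zero1_bounds R.
rewrite ltr_norml ltrBrDr ltrBlDr; apply/andP; split.
  by rewrite ltr_pdivlMr; lra.
by rewrite ltr_pdivrMr; lra.
Qed.

(** * Lebesgue measure on the plane and its invariance under shears and rotations *)

Section PlaneMeasure.
Context {R : realType}.
Local Notation mR := (measurableTypeR R).
Local Notation mu := (@lebesgue_measure R).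

Lemma lebesgue_measure_translate (t : R) (A : set R) : measurable A ->
  mu ((fun x => x + t) @^-1` A) = mu A.
Proof.
have mt : measurable_fun setT (fun x : mR => (x + t : mR)) by exact: measurable_funD.
move=> mA; have := @lebesgue_measure_unique R (pushforward mu (fun x : mR => (x + t : mR))).
move=> /(_ mt _ _ mA) -> // _ [[a b]] _ <- /=.
rewrite /pushforward (_ : _ @^-1` _ = `]a - t, b - t]%classic); last first.
  by apply/seteqP; split => x /=; rewrite !in_itv/= ltrBlDr lerBrDr.
rewrite !lebesgue_measure_itv/= !lte_fin ltrD2r; case: ifP => // _.
by rewrite -!EFinB; congr (_%:E); ring.
Qed.

Lemma lebesgue_measure_scale (a : R) (A : set R) : a != 0 -> measurable A ->
  (`|a|%:E * mu (( *%R a) @^-1` A))%E = mu A.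
Proof.
move=> a0 mA; have ma : measurable_fun setT (fun x : mR => (a * x : mR)).
  exact: mulrl_measurable.
have := @lebesgue_measure_unique R
  (mscale (NngNum (normr_ge0 a)) (pushforward mu (fun x : mR => (a * x : mR)))).
move=> /(_ ma _ _ mA) -> // _ [[x y]] _ <- /=.
rewrite /mscale/= /pushforward.
have [an|ap|/eqP] := ltgtP a 0; last by rewrite (negbTE a0).
  rewrite (_ : _ @^-1` _ = `[y / a, x / a[%classic); last first.
    apply/seteqP; split => z /=; rewrite !in_itv/= ler_ndivrMr// ltr_ndivlMr// mulrC;
    by rewrite andbC.
  rewrite !lebesgue_measure_itv/= !lte_fin ltr_ndivrMr// divfK//.
  case: ifPn => _; last by rewrite mule0.
  by rewrite ltr0_norm// -!EFinB -EFinM; congr (_%:E); field.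
rewrite (_ : _ @^-1` _ = `]x / a, y / a]%classic); last first.
  by apply/seteqP; split => z /=; rewrite !in_itv/= ltr_pdivrMr// ler_pdivlMr// mulrC.
rewrite !lebesgue_measure_itv/= !lte_fin ltr_pdivrMr// divfK//.
case: ifPn => _; last by rewrite mule0.
by rewrite gtr0_norm// -!EFinB -EFinM; congr (_%:E); field.
Qed.

Lemma ge0_integral_scale (a : R) (f : R -> \bar R) : a != 0 ->
  measurable_fun setT f -> (forall x, 0 <= f x)%E ->
  (\int[mu]_x f x = \int[mu]_x (`|a|%:E * f (a * x)%R))%E.
Proof.
move=> a0 mf f0.
have ma : measurable_fun setT (fun x : mR => (a * x : mR)) by exact: mulrl_measurable.
rewrite ge0_integralZl//=; last by apply: measurableT_comp mf ma.
have <- := @ge0_integral_pushforward _ _ mR mR R _ ma mu setT f measurableT mf (fun x _ => f0 x).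
rewrite -[`|a|]/((NngNum (normr_ge0 a))%:num) -ge0_integral_mscale//.
by apply: eq_measure_integral => A mA _; rewrite -[RHS]/(_ * _)%E lebesgue_measure_scale.
Qed.

(** An open set is the union of the boxes with rational ends that it contains, a countable
    family. *)
Lemma open_measurable_prod (A : set (R * R)) : open A ->
  measurable (A : set (mR * mR)).
Proof.
move=> oA.
pose box (q : (rat * rat) * (rat * rat)) : set (R * R) :=
  `]ratr q.1.1, ratr q.1.2[ `*` `]ratr q.2.1, ratr q.2.2[.
have -> : A = \bigcup_(q in [set q | box q `<=` A]) box q.
  apply/seteqP; split=> [[x y] Axy|z [q /= qA]]; last exact: qA.
  have [e /= e0 eA] := (nbhs_ballP _ _).1 (open_nbhs_nbhs (conj oA Axy)).
  have approx (z : R) : exists q : rat * rat,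
      [/\ z \in `]ratr q.1, ratr q.2[, z - e < ratr q.1 & ratr q.2 < z + e].
    have [q1] : exists q : rat, ratr q \in `]z - e, z[ by apply: rat_in_itvoo; lra.
    have [q2] : exists q : rat, ratr q \in `]z, z + e[ by apply: rat_in_itvoo; lra.
    rewrite !in_itv/= => /andP[? ?] /andP[? ?]; exists (q1, q2) => /=.
    by rewrite in_itv/=; split=> //; apply/andP.
  have [q1 [xq1 q1l q1r]] := approx x; have [q2 [yq2 q2l q2r]] := approx y.
  exists (q1, q2) => //= -[u v] [/=]; rewrite !in_itv/= => /andP[? ?] /andP[? ?].
  by apply: eA; split => /=; rewrite /ball/= ltr_norml; apply/andP; lra.
rewrite bigcup_mkcond; apply: countable_bigcupT_measurable; first exact: countableP.
move=> q.
case: ifPn => // _; apply: measurableX; exact: measurable_itv.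
Qed.

Local Notation area := (@area R).

(** [area] unfolds to vertical sections, which suit [yshear]; [xshear] translates the horizontal
    ones. *)
Lemma area_ysection (A : set (mR * mR)) : measurable A ->
  area A = (\int[mu]_y mu (ysection A y))%E.
Proof.
move=> mA; rewrite -[LHS]/((mu \x mu)%E A).
have := @product_measure_unique _ _ mR mR R mu mu (mu \x^ mu)%E.
move=> /(_ _ A mA) -> // B C mB mC; exact: product_measure2E.
Qed.

Definition xshear (t : R) (z : R * R) : R * R := (z.1 + t * z.2, z.2).
Definition yshear (t : R) (z : R * R) : R * R := (z.1, z.2 + t * z.1).

Lemma measurable_scale_prod k (f : mR * mR -> mR) :
  measurable_fun setT f -> measurable_fun setT (fun z => k * f z : mR).
Proof. by move=> mf; apply: measurable_realfun.measurable_funM. Qed.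

Lemma measurable_xshear t : measurable_fun setT (xshear t : mR * mR -> mR * mR).
Proof.
apply/measurable_fun_pairP; split => /=; last exact: measurable_snd.
apply: measurable_realfun.measurable_funD; first exact: measurable_fst.
by apply: measurable_scale_prod; exact: measurable_snd.
Qed.

Lemma measurable_yshear t : measurable_fun setT (yshear t : mR * mR -> mR * mR).
Proof.
apply/measurable_fun_pairP; split => /=; first exact: measurable_fst.
apply: measurable_realfun.measurable_funD; first exact: measurable_snd.
by apply: measurable_scale_prod; exact: measurable_fst.
Qed.

Lemma measurable_preimage (phi : mR * mR -> mR * mR) (A : set (mR * mR)) :
  measurable_fun setT phi -> measurable A -> measurable (phi @^-1` A).
Proof. by move=> mphi mA; rewrite -[X in measurable X]setTI; exact: mphi. Qed.

Lemma area_xshear t (A : set (mR * mR)) : measurable A ->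
  area (xshear t @^-1` A) = area A.
Proof.
move=> mA; rewrite !area_ysection//; last exact: measurable_preimage (measurable_xshear t) mA.
apply: eq_integral => y _.
rewrite -(@lebesgue_measure_translate (t * y) (ysection A y)); last exact: measurable_ysection.
by congr (mu _); apply/seteqP; split => x; rewrite /ysection/= !inE.
Qed.

Lemma area_yshear t (A : set (mR * mR)) : measurable A ->
  area (yshear t @^-1` A) = area A.
Proof.
move=> mA; apply: eq_integral => x _ /=.
rewrite -(@lebesgue_measure_translate (t * x) (xsection A x)); last exact: measurable_xsection.
by congr (mu _); apply/seteqP; split => y; rewrite /xsection/= !inE.
Qed.

Definition rot (c s : R) (z : R * R) : R * R := (c * z.1 - s * z.2, s * z.1 + c * z.2).

Lemma measurable_rot c s : measurable_fun setT (rot c s : mR * mR -> mR * mR).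
Proof.
apply/measurable_fun_pairP; split => /=;
  [apply: measurable_realfun.measurable_funB|apply: measurable_realfun.measurable_funD];
  apply: measurable_scale_prod; by [exact: measurable_fst|exact: measurable_snd].
Qed.

(* Away from the half turn a rotation is a product of three shears; the half turn is
   the square of a quarter turn. *)
Lemma area_rot c s (A : set (mR * mR)) : c ^+ 2 + s ^+ 2 = 1 -> measurable A ->
  area (rot c s @^-1` A) = area A.
Proof.
move=> cs1 mA.
have main (c' s' : R) B : c' ^+ 2 + s' ^+ 2 = 1 -> c' != -1 -> measurable (B : set (mR * mR)) ->
    area (rot c' s' @^-1` B) = area B.
  move=> cs' c'N1 mB.
  have c1 : 1 + c' != 0 by rewrite addrC addr_eq0.
  (* The tangent of half the rotation angle. *)
  pose t := s' / (1 + c').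
  have tc : t * (1 + c') = s' by rewrite /t divfK.
  have ts : t * s' = 1 - c'.
    apply: (mulIf c1); rewrite mulrAC tc; have -> : s' * s' = 1 - c' ^+ 2 by rewrite -cs'; ring.
    by ring.
  have m1 := measurable_preimage (measurable_xshear (- t)) mB.
  have m2 := measurable_preimage (measurable_yshear s') m1.
  have -> : rot c' s' = xshear (- t) \o yshear s' \o xshear (- t).
    apply/funext => -[x y]; rewrite /rot /xshear /yshear/=; congr pair.
      have -> : x + - t * y + - t * (y + s' * (x + - t * y)) =
        (1 - t * s') * x - (2 * t - t * s' * t) * y by ring.
      by rewrite ts -{1}tc; ring.
    have -> : y + s' * (x + - t * y) = s' * x + (1 - t * s') * y by ring.
    by rewrite ts; ring.
  apply: etrans (area_xshear (- t) mB); apply: etrans (area_yshear s' m1).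
  exact: (area_xshear (- t) m2).
have [c1|c1] := eqVneq c (-1); last exact: main.
have s0 : s = 0.
  by apply/eqP; rewrite -sqrf_eq0; apply/eqP; move: cs1; rewrite c1 sqrrN expr1n; lra.
have q (B : set (mR * mR)) : measurable B -> area (rot 0 1 @^-1` B) = area B.
  by apply: main; [ring|rewrite eq_sym oppr_eq0 oner_eq0].
have -> : rot c s = rot 0 1 \o rot 0 1.
  by apply/funext => -[x y]; rewrite /rot /= c1 s0; congr pair; ring.
apply: etrans (q _ mA); exact: (q _ (measurable_preimage (measurable_rot 0 1) mA)).
Qed.

End PlaneMeasure.

Lemma bessel_primitive_le_affine (R : realFieldType) (v : R) : 0 <= v <= (22 / 7) ^+ 2 ->
  2 * (v - v ^+ 2 / 2 + v ^+ 3 / 12 - v ^+ 4 / 144 + v ^+ 5 / 2880 - v ^+ 6 / (120 * 720)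
    + v ^+ 7 / (720 * 5040) - v ^+ 8 / (5040 ^+ 2 * 8) + v ^+ 9 / ((5040 * 8) ^+ 2 * 9))
  < 78 / 1000 * (2284 / 100 - 4 * v).
Proof.
move=> /andP[v0 vV].
have [v2|/ltW v2] := lerP v 2.
- have {}vV : 0 <= v <= 2 by rewrite v0.
  have B i j := @bernstein_ge0 R _ _ v i j vV.
  have := B 0%N 9%N; have := B 1%N 8%N; have := B 2%N 7%N; have := B 3%N 6%N; have := B 4%N 5%N.
  have := B 5%N 4%N; have := B 6%N 3%N; have := B 7%N 2%N; have := B 8%N 1%N; have := B 9%N 0%N.
  clear B vV v0 v2; rewrite !expr0; lra.
- have B i j : 0 <= (49 * v - 98) ^+ i * (484 - 49 * v) ^+ j.
    by apply: bernstein_ge0; apply/andP; lra.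
  have := B 0%N 9%N; have := B 1%N 8%N; have := B 2%N 7%N; have := B 3%N 6%N; have := B 4%N 5%N.
  have := B 5%N 4%N; have := B 6%N 3%N; have := B 7%N 2%N; have := B 8%N 1%N; have := B 9%N 0%N.
  clear B vV v0 v2; rewrite !expr0; lra.
Qed.

(** * Integrals along a line through the origin *)

Section Radial.
Context {R : realType}.
Local Notation mR := (measurableTypeR R).
Local Notation mu := (@lebesgue_measure R).

Lemma integral_deriv (F f : R -> R) (a b : R) : a <= b ->
  (forall x : R, is_derive x 1 F (f x)) -> continuous f ->
  (\int[mu]_(x in `[a, b]) (f x)%:E = (F b - F a)%:E)%E.
Proof.
rewrite le_eqVlt => /predU1P[->|ab] dF cf.
  by rewrite set_itv1 integral_set1 subrr.
have dF1 x : derivable F x 1 by have [] := dF x.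
have cF : continuous F by move=> x; apply/differentiable_continuous/derivable1_diffP.
rewrite (@continuous_FTC2 R f F a b ab)//.
- by apply: continuous_subspaceT => x; exact: cf.
- split; first by move=> x _.
    by apply: cvg_at_right_filter; exact: cF.
  by apply: cvg_at_left_filter; exact: cF.
- by move=> x _; rewrite derive1E; have [_ ->] := dF x.
Qed.

Lemma integral_horner_deriv (F : {poly R}) (a b : R) : a <= b ->
  (\int[mu]_(x in `[a, b]) (F^`().[x])%:E = (F.[b] - F.[a])%:E)%E.
Proof. by move=> ab; apply: integral_deriv => // x; exact: continuous_horner. Qed.

Lemma measurable_radial (p : {poly R}) k (D : set mR) :
  measurable_fun D (fun x : mR => (`|x| * p.[k * x ^+ 2])%:E).
Proof.
apply/measurable_EFinP/measurable_realfun.measurable_funM; first exact: measurable_funTS.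
rewrite (_ : (fun x => _) = horner (p \Po (k *: 'X^2))); last first.
  by apply/funext => x; rewrite horner_comp !hornerE.
by apply: measurable_funTS; apply: continuous_measurable_fun; exact: continuous_horner.
Qed.

Lemma integral_radial_segment (P : {poly R}) (k g : R) : 0 < k -> 0 <= g ->
  (forall v, 0 <= v <= k * g ^+ 2 -> 0 <= P^`().[v]) ->
  (\int[mu]_(x in `[(- g)%R, g]) (`|x| * P^`().[k * x ^+ 2])%:E =
    ((P.[k * g ^+ 2] - P.[0]) / k)%:E)%E.
Proof.
move=> k0 g0 P0.
pose F : {poly R} := (2 * k)^-1 *: (P \Po (k *: 'X^2)).
have F' x : F^`().[x] = x * P^`().[k * x ^+ 2].
  rewrite derivZ deriv_comp derivZ derivXn hornerZ hornerM horner_comp !hornerE/=.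
  by rewrite expr1; field; rewrite gt_eqF.
have Fx x : F.[x] = (2 * k)^-1 * P.[k * x ^+ 2] by rewrite hornerZ horner_comp !hornerE.
have pos (x : R) : x \in `[- g, g] -> 0 <= P^`().[k * x ^+ 2].
  rewrite in_itv/= => /andP[gx xg]; apply: P0.
  rewrite mulr_ge0 ?sqr_ge0 ?(ltW k0)//= ler_pM2l//.
  by rewrite -[x ^+ 2]real_normK ?num_real// ler_sqr ?nnegrE// ler_norml gx.
have mf := measurable_radial P^`() k.
have -> : `[- g, g]%classic = `[- g, 0] `|` `]0, g] :> set R.
  by rewrite -itv_bndbnd_setU// bnd_simp// oppr_le0.
rewrite ge0_integral_setU//=; first last.
- rewrite disj_set2E; apply/eqP; rewrite -subset0 => x []/=.
  by rewrite !in_itv/= => /andP[_ +] /andP[+ _] => /le_lt_trans/[apply]; rewrite ltxx.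
- move=> x gx; rewrite lee_fin mulr_ge0// pos//.
  by move: gx => []/=; rewrite !in_itv/= => /andP[? ?]; apply/andP; lra.
rewrite (@integral_itv_obnd_cbnd _ 0 (BRight g)); last exact: mf.
have -> : (\int[mu]_(x in `[(- g)%R, 0%R]) (`|x| * P^`().[k * x ^+ 2])%:E = (F.[- g] - F.[0])%:E)%E.
  transitivity (((- F).[0] - (- F).[- g])%:E); last by rewrite !hornerN opprK addrC.
  rewrite -integral_horner_deriv ?oppr_le0//; apply: eq_integral => x.
  by rewrite inE/= in_itv/= => /andP[_ x0]; rewrite derivN hornerN F' ler0_norm// mulNr.
have -> : (\int[mu]_(x in `[0%R, g]) (`|x| * P^`().[k * x ^+ 2])%:E = (F.[g] - F.[0])%:E)%E.
  rewrite -integral_horner_deriv//; apply: eq_integral => x.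
  by rewrite inE/= in_itv/= => /andP[x0 _]; rewrite F' ger0_norm.
rewrite -EFinD; congr (_%:E); rewrite !Fx sqrrN expr0n/= mulr0.
by field; rewrite gt_eqF.
Qed.

(** [I] lies between the open and the closed interval with ends [- sup I] and [sup I], over which
    the integrals agree. *)
Lemma integral_radial_star (P : {poly R}) (k : R) (I : set R) : 0 < k ->
  measurable I -> (forall x y, I x -> `|y| <= `|x| -> I y) -> has_ubound I ->
  (forall v, 0 <= v <= k * sup I ^+ 2 -> 0 <= P^`().[v]) ->
  (\int[mu]_(x in I) (`|x| * P^`().[k * x ^+ 2])%:E =
    ((P.[k * sup I ^+ 2] - P.[0]) / k)%:E)%E.
Proof.
move=> k0 mI starI ubI P0; set g := sup I.
(* If [0] is not in [I], then [I] is empty, and the default [sup set0 = 0] makes both sides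
   vanish. *)
have [I0|nI0] := pselect (I 0); last first.
  have IE : I = set0 by apply/seteqP; split => // x Ix; apply: nI0; apply: starI Ix _; rewrite normr0.
  by rewrite /g IE integral_set0 sup0 expr0n/= mulr0 subrr mul0r.
have supI : has_sup I by split => //; exists 0.
have g0 : 0 <= g by exact: ub_le_sup.
have Ig : I `<=` `[- g, g].
  move=> x Ix; rewrite /= in_itv/= -ler_norml; apply: ub_le_sup => //.
  by apply: starI Ix _; rewrite normr_id.
have gI : `]- g, g[ `<=` I.
  move=> x; rewrite /= in_itv/= -ltr_norml => /(sup_gt (ex_intro _ 0 I0))[y Iy xy].
  by apply: starI Iy _; rewrite (le_trans (ltW xy))// ler_norm.
have mf := measurable_radial P^`() k.
have pos x : `[- g, g]%classic x -> (0 <= (`|x| * P^`().[k * x ^+ 2])%:E)%E.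
  move=> xg; rewrite lee_fin mulr_ge0// P0// mulr_ge0 ?sqr_ge0 ?(ltW k0)//= ler_pM2l//.
  rewrite -[x ^+ 2]real_normK ?num_real// ler_sqr ?nnegrE// ler_norml.
  by move: xg; rewrite /= in_itv.
rewrite -(integral_radial_segment k0 g0 P0); apply/eqP; rewrite eq_le; apply/andP; split.
  by apply: ge0_subset_integral => //; exact: mf.
rewrite -integral_itv_bndo_bndc; last exact: mf.
rewrite -integral_itv_obnd_cbnd; last exact: mf.
apply: (@ge0_subset_integral _ mR R mu `]- g, g[%classic I);
  [exact: measurable_itv|by []|exact: mf| |exact: gI].
by move=> x /Ig; exact: pos.
Qed.

End Radial.

(** * Polar coordinates by slope, and areas of disks *)

Section Polar.
Context {R : realType}.
Local Notation mR := (measurableTypeR R).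
Local Notation mu := (@lebesgue_measure R).
Local Notation area := (@area R).

Lemma measurable_slope : measurable_fun setT (fun z : mR * mR => (z.1, z.1 * z.2) : mR * mR).
Proof.
apply/measurable_fun_pairP; split => /=; first exact: measurable_fst.
by apply: measurable_realfun.measurable_funM; [exact: measurable_fst|exact: measurable_snd].
Qed.

(* Polar coordinates with the slope [u = y / x] in place of the angle. *)
Lemma ge0_integral_slope (f : mR * mR -> \bar R) :
  measurable_fun setT f -> (forall z, 0 <= f z)%E ->
  (\int[area]_z f z = \int[mu]_u \int[mu]_x (`|x|%:E * f (x, (x * u)%R)))%E.
Proof.
move=> mf f0.
pose g (z : mR * mR) : \bar R := (`|z.1|%:E * f (z.1, (z.1 * z.2)%R))%E.
have mg : measurable_fun setT g.
  apply: emeasurable_funM; last exact: measurableT_comp measurable_slope.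
  apply/measurable_EFinP; apply: measurableT_comp; [exact: normr_measurable|exact: measurable_fst].
have g0 z : (0 <= g z)%E by rewrite mule_ge0.
transitivity (\int[mu]_x fubini_F mu g x)%E; last exact: fubini_tonelli.
transitivity (\int[mu]_x fubini_F mu f x)%E; first exact: fubini_tonelli1.
apply: ge0_ae_eq_integral => //.
- exact: measurable_fun_fubini_tonelli_F.
- exact: measurable_fun_fubini_tonelli_F.
- by move=> x _; exact: integral_ge0.
- by move=> x _; exact: integral_ge0.
(* The substitution y = x * u degenerates only at x = 0. *)
exists [set 0]; split => //; first exact: lebesgue_measure_set1.
move=> x /=; apply: contra_notP => /eqP x0 _.
apply: ge0_integral_scale => //; exact: measurableT_comp.
Qed.

(** Indexed by the squared radius, so that the area is linear in [c]. *)
Definition sqdisk (c : R) : set (R * R) := [set x | dotp x x < c].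

Lemma measurable_sqnorm : measurable_fun setT (fun x : mR * mR => dotp x x : mR).
Proof.
apply: measurable_realfun.measurable_funD; apply: measurable_realfun.measurable_funM;
  by [exact: measurable_fst|exact: measurable_snd].
Qed.

Lemma measurable_sqdisk c : measurable (sqdisk c : set (mR * mR)).
Proof.
rewrite (_ : sqdisk c = setT `&` (fun x : mR * mR => dotp x x : mR) @^-1` `]-oo, c[); last first.
  by rewrite setTI; apply/seteqP; split => x /=; rewrite in_itv.
by apply: measurable_sqnorm => //; exact: measurable_itv.
Qed.

Lemma area_box_lty (A : set (R * R)) (M : R) : measurable (A : set (mR * mR)) ->
  (forall x, A x -> `|x.1| <= M /\ `|x.2| <= M) -> (area A < +oo)%E.
Proof.
move=> mA AM; have mi : measurable (`[- M, M]%classic : set mR) by exact: measurable_itv.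
apply: (@le_lt_trans _ _ (area (`[- M, M] `*` `[- M, M]))).
  apply: le_measure; rewrite ?inE//; first exact: measurableX.
  by move=> x /AM[x1 x2]; split; rewrite /= in_itv/= -ler_norml.
have -> : (area (`[(- M)%R, M] `*` `[(- M)%R, M]) = mu `[(- M)%R, M] * mu `[(- M)%R, M])%E.
  exact: product_measure1E.
rewrite !lebesgue_measure_itv/=.
by case: ifP => _; rewrite ?mule0// ?mul0e// -EFinB -EFinM ltry.
Qed.

Lemma area_sqnorm_lty (A : set (R * R)) (V : R) : measurable (A : set (mR * mR)) ->
  (forall x, A x -> dotp x x <= V) -> (area A < +oo)%E.
Proof.
move=> mA AV; apply: (@area_box_lty _ (V + 1)) => // x /AV; rewrite /dotp => xV.
have bnd (y z : R) : y * y + z * z <= V -> `|y| <= V + 1.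
  move=> yV; rewrite ler_norml; apply/andP; split; nra.
by split; apply: bnd; [exact: xV|rewrite addrC; exact: xV].
Qed.

Lemma ray_sqnorm x u : dotp (x, x * u) (x, x * u) = (1 + u ^+ 2) * x ^+ 2 :> R.
Proof. by rewrite /dotp/=; ring. Qed.

Lemma ray_coef_gt0 u : 0 < 1 + u ^+ 2 :> R.
Proof. by rewrite ltr_wpDr// sqr_ge0. Qed.

Lemma measurable_ray (A : set (R * R)) u : measurable (A : set (mR * mR)) ->
  measurable ((fun x => (x, x * u)) @^-1` A : set mR).
Proof.
move=> mA; rewrite -[X in measurable X]setTI.
have : measurable_fun setT (fun x : mR => (x, x * u) : mR * mR).
  apply/measurable_fun_pairP; split => /=; first exact: measurable_id.
  exact: mulrr_measurable.
by apply.
Qed.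

Lemma sup_sqrt_itv (k c : R) : 0 < k -> 0 <= c ->
  k * sup [set x : R | k * x ^+ 2 < c] ^+ 2 = c.
Proof.
move=> k0 c0; have [->|cn0] := eqVneq c 0.
  rewrite (_ : mkset _ = set0) ?sup0 ?expr0n/= ?mulr0//; apply/seteqP; split => // x /=.
  by rewrite ltNge mulr_ge0 ?sqr_ge0// ltW.
have s0 : 0 < Num.sqrt (c / k) by rewrite sqrtr_gt0 divr_gt0// lt_neqAle eq_sym cn0.
rewrite (_ : mkset _ = `]- Num.sqrt (c / k), Num.sqrt (c / k)[%classic); last first.
  apply/seteqP; split => x /=; rewrite in_itv/= -ltr_norml -sqrtr_sqr ltr_sqrt ?sqrtr_gt0//;
    by rewrite ?divr_gt0// ?ltr_pdivlMr 1?mulrC// lt_neqAle eq_sym cn0.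
rewrite real_interval.sup_itv//= ?bnd_simp; last by rewrite (lt_trans _ s0)// oppr_lt0.
by rewrite sqr_sqrtr ?divr_ge0 ?(ltW k0)// mulrC divfK// gt_eqF.
Qed.

(** Negative [t] is included, so each line through the origin meets [A] in a symmetric interval. *)
Definition star_shaped (A : set (R * R)) := forall x (t : R), A x -> `|t| <= 1 -> A (t * x.1, t * x.2).

(** Measured on the first axis: the Euclidean length of the ray is this times sqrt (1 + u ^ 2). *)
Definition ray_len (A : set (R * R)) u := sup ((fun x => (x, x * u)) @^-1` A).

Lemma ray_len_sqr_le (A : set (R * R)) (V u : R) : 0 <= V ->
  (forall x, A x -> dotp x x <= V) -> (1 + u ^+ 2) * ray_len A u ^+ 2 <= V.
Proof.
move=> V0 AV; have k0 := ray_coef_gt0 u; rewrite /ray_len; set I := _ @^-1` A.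
have IV x : I x -> `|x| <= Num.sqrt (V / (1 + u ^+ 2)).
  move=> /AV; rewrite ray_sqnorm -sqrtr_sqr => xV.
  by rewrite ler_wsqrtr// ler_pdivlMr// mulrC.
have [[i Ii]|nI] := pselect (I !=set0); last first.
  rewrite (_ : I = set0) ?sup0 ?expr0n/= ?mulr0//.
  by apply/seteqP; split => // x Ix; apply: nI; exists x.
have gV : `|sup I| <= Num.sqrt (V / (1 + u ^+ 2)).
  rewrite ler_norml; apply/andP; split.
    apply: (@le_trans _ _ i); first by have := IV _ Ii; rewrite ler_norml => /andP[].
    apply: ub_le_sup => //; exists (Num.sqrt (V / (1 + u ^+ 2))) => x /IV.
    by apply: le_trans; exact: ler_norm.
  apply: ge_sup; first by exists i.
  by move=> x /IV; apply: le_trans; exact: ler_norm.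
rewrite mulrC -ler_pdivlMr// -[sup I ^+ 2]real_normK ?num_real//.
rewrite -(@sqr_sqrtr _ (V / _)) ?divr_ge0 ?(ltW k0)//.
by rewrite ler_sqr ?nnegrE// sqrtr_ge0.
Qed.

Lemma integral_ray (A : set (R * R)) (P : {poly R}) (V u : R) :
  measurable (A : set (mR * mR)) -> star_shaped A -> 0 <= V ->
  (forall x, A x -> dotp x x <= V) -> (forall v, 0 <= v <= V -> 0 <= P^`().[v]) ->
  let k := 1 + u ^+ 2 in
  (\int[mu]_x (`|x|%:E * (P^`().[dotp (x, (x * u)%R) (x, (x * u)%R)] * \1_A (x, (x * u)%R))%:E) =
    ((P.[k * ray_len A u ^+ 2] - P.[0]) / k)%:E)%E.
Proof.
move=> mA starA V0 AV P0 k; have k0 : 0 < k := ray_coef_gt0 u.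
rewrite /ray_len; set I := _ @^-1` A.
rewrite -integral_radial_star//.
- rewrite [RHS]integral_mkcond; apply: eq_integral => x _ /=.
  rewrite patchE indicE ray_sqnorm.
  have -> : (x \in I) = ((x, x * u) \in A) by apply/idP/idP; rewrite !inE.
  by case: ifP => _; rewrite ?mulr1 -?EFinM ?mulr0.
- exact: measurable_ray.
- move=> x y Ix yx; have [x0|x0] := eqVneq x 0.
    by move: yx; rewrite x0 normr0 normr_le0 => /eqP ->; move: Ix; rewrite x0.
  have := starA _ (y / x) Ix; rewrite /= normf_div ler_pdivrMr ?normr_gt0// mul1r => /(_ yx).
  by rewrite /I/= mulrA divfK.
- exists (V + 1) => x /AV; rewrite ray_sqnorm => xV.
  have : x ^+ 2 <= V by apply: le_trans xV; rewrite ler_peMl ?sqr_ge0// lerDl sqr_ge0.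
  by rewrite expr2 => ?; nra.
- move=> v /andP[v0 vk]; apply: P0; rewrite v0 (le_trans vk)//.
  exact: ray_len_sqr_le.
Qed.

Lemma star_shaped_sqdisk c : star_shaped (sqdisk c).
Proof.
move=> x t; rewrite /sqdisk /dotp/= => xc t1; apply: le_lt_trans xc.
have -> : t * x.1 * (t * x.1) + t * x.2 * (t * x.2) = t ^+ 2 * (x.1 * x.1 + x.2 * x.2) by ring.
rewrite ler_piMl ?addr_ge0 -?expr2 ?sqr_ge0// -[t ^+ 2]real_normK ?num_real//.
by rewrite -[leRHS](expr1n _ 2) ler_sqr ?nnegrE.
Qed.

Lemma ray_len_sqdisk (c u : R) : 0 <= c -> (1 + u ^+ 2) * ray_len (sqdisk c) u ^+ 2 = c.
Proof.
move=> c0; rewrite -[RHS](sup_sqrt_itv (ray_coef_gt0 u) c0) /ray_len.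
by congr (_ * sup _ ^+ 2); apply/seteqP; split => x; rewrite /sqdisk/= ray_sqnorm.
Qed.

Lemma area_sqdisk_fin c : area (sqdisk c) \is a fin_num.
Proof.
rewrite ge0_fin_numE//; apply: (@area_sqnorm_lty _ c); first exact: measurable_sqdisk.
by move=> x /ltW.
Qed.

Lemma integral_ray_sqdisk (c b u : R) : 0 <= c -> 0 <= b ->
  (\int[mu]_x (`|x|%:E * (b * \1_(sqdisk c) (x, (x * u)%R))%:E) = (b * c / (1 + u ^+ 2))%:E)%E.
Proof.
move=> c0 b0.
have dE v : (b *: 'X : {poly R})^`().[v] = b by rewrite derivZ derivX !hornerE.
have := @integral_ray (sqdisk c) (b *: 'X) c u (measurable_sqdisk c) (@star_shaped_sqdisk c) c0
  (fun x xc => ltW xc).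
rewrite /= ray_len_sqdisk// !hornerE subr0 => <-; last by move=> v _; rewrite dE.
by apply: eq_integral => x _; rewrite dE.
Qed.

Lemma continuous_inv_ray : continuous (fun u : R => (1 + u ^+ 2)^-1).
Proof.
move=> u; apply: cvgV; first by rewrite gt_eqF// ray_coef_gt0.
by apply: cvgD; [exact: cvg_cst|exact: exprn_continuous].
Qed.

(** In slope coordinates the area is the integral of [c / (1 + u ^+ 2)] over all slopes. *)
Lemma area_sqdiskM (c : R) : 0 <= c -> (area (sqdisk c) = c%:E * area (sqdisk 1))%E.
Proof.
have E (b : R) : 0 <= b -> (area (sqdisk b) = \int[mu]_u (b / (1 + u ^+ 2))%:E)%E.
  move=> b0; rewrite -(setIT (sqdisk b)) -integral_indic//; last exact: measurable_sqdisk.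
  rewrite ge0_integral_slope//; last first.
    by apply/measurable_EFinP/measurable_indic; exact: measurable_sqdisk.
  apply: eq_integral => u _; rewrite -[b in RHS]mul1r -integral_ray_sqdisk//.
  by apply: eq_integral => x _; rewrite mul1r.
move=> c0; rewrite !E//.
under eq_integral do rewrite EFinM.
rewrite ge0_integralZl//.
- by congr (_ * _)%E; apply: eq_integral => u _; rewrite mul1r.
- apply/measurable_EFinP; apply: measurable_funTS; apply: continuous_measurable_fun.
  exact: continuous_inv_ray.
- by move=> u _; rewrite lee_fin invr_ge0 ltW// ray_coef_gt0.
Qed.

Lemma area_sqdisk1_gt0 : 0 < fine (area (sqdisk 1)).
Proof.
apply: fine_gt0; rewrite -ge0_fin_numE// area_sqdisk_fin andbT.
have mi : measurable (`[- 2^-1, 2^-1]%classic : set mR) by exact: measurable_itv.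
apply: (@lt_le_trans _ _ (area (`[- 2^-1, 2^-1] `*` `[- 2^-1, 2^-1]))).
  have -> : (area (`[(- 2^-1)%R, 2^-1%R] `*` `[(- 2^-1)%R, 2^-1%R]) =
      mu `[(- 2^-1)%R, 2^-1%R] * mu `[(- 2^-1)%R, 2^-1%R])%E.
    exact: product_measure1E.
  have h : - 2^-1 < 2^-1 :> R by lra.
  rewrite !lebesgue_measure_itv/= lte_fin h.
  by rewrite -EFinB -EFinM lte_fin; lra.
apply: le_measure; rewrite ?inE; [exact: measurableX|exact: measurable_sqdisk|].
move=> [x y] [/=]; rewrite !in_itv/= /sqdisk/= /dotp/= => /andP[? ?] /andP[? ?].
nra.
Qed.

End Polar.

(** * Comparison of a radial integral with the area of a disk *)

Section RadialBound.
Context {R : realType}.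
Local Notation mR := (measurableTypeR R).
Local Notation mu := (@lebesgue_measure R).
Local Notation area := (@area R).

Lemma measurable_integral_slope (f : mR * mR -> \bar R) :
  measurable_fun setT f -> (forall z, 0 <= f z)%E ->
  measurable_fun setT (fun u => \int[mu]_x (`|x|%:E * f (x, (x * u)%R)))%E.
Proof.
move=> mf f0.
pose g (z : mR * mR) : \bar R := (`|z.1|%:E * f (z.1, (z.1 * z.2)%R))%E.
apply: (@measurable_fun_fubini_tonelli_G _ _ mR mR R mu g).
- apply: emeasurable_funM; last exact: measurableT_comp measurable_slope.
  apply/measurable_EFinP; apply: measurableT_comp; [exact: normr_measurable|exact: measurable_fst].
- by move=> z; rewrite mule_ge0.
Qed.

Lemma measurable_ray_fun (f : mR * mR -> \bar R) u : measurable_fun setT f ->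
  measurable_fun setT (fun x : mR => `|x|%:E * f (x, (x * u)%R))%E.
Proof.
move=> mf; have mr : measurable_fun setT (fun x : mR => (x, x * u) : mR * mR).
  apply/measurable_fun_pairP; split => /=; first exact: measurable_id.
  exact: mulrr_measurable.
apply: emeasurable_funM; last exact: measurableT_comp mf mr.
by apply/measurable_EFinP; exact: normr_measurable.
Qed.

Lemma le_integral_slope (f g : mR * mR -> \bar R) :
  measurable_fun setT f -> (forall z, 0 <= f z)%E ->
  measurable_fun setT g -> (forall z, 0 <= g z)%E ->
  (forall u, \int[mu]_x (`|x|%:E * f (x, (x * u)%R)) <= \int[mu]_x (`|x|%:E * g (x, (x * u)%R)))%E ->
  (\int[area]_z f z <= \int[area]_z g z)%E.
Proof.
move=> mf f0 mg g0 fg; rewrite !ge0_integral_slope//; apply: ge0_le_integral => //.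
- by move=> u _; apply: integral_ge0 => x _; rewrite mule_ge0.
- exact: measurable_integral_slope.
- exact: measurable_integral_slope.
Qed.

Lemma integrable_bounded (A : set (R * R)) (f : R * R -> R) (B : R) :
  measurable (A : set (mR * mR)) -> (area A < +oo)%E ->
  measurable_fun setT (f : mR * mR -> mR) -> (forall x, A x -> `|f x| <= B) ->
  area.-integrable A (EFin \o f).
Proof.
move=> mA Aoo mf fB; apply: measurable_bounded_integrable => //.
  exact: measurable_funTS mf.
exists B; split; first exact: num_real.
by move=> M BM x Ax; exact: le_trans (fB x Ax) (ltW BM).
Qed.

Lemma horner_bounded (p : {poly R}) (V : R) : 0 <= V ->
  exists2 M : R, 0 <= M & forall v : R, 0 <= v <= V -> `|p.[v]| <= M.
Proof.
move=> V0; have [c _ cmax] : exists2 c : R, c \in `[0, V] &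
    forall t : R, t \in `[0, V] -> `|p.[t]| <= `|p.[c]|.
  apply: EVT_max => //; apply: continuous_subspaceT => x.
  apply: continuous_comp; [exact: continuous_horner|exact: norm_continuous].
by exists `|p.[c]| => // v vV; apply: cmax; rewrite in_itv.
Qed.

Lemma measurable_horner_sqnorm (p : {poly R}) :
  measurable_fun setT (fun z : mR * mR => p.[dotp z z] : mR).
Proof.
have mp : measurable_fun setT (horner p : mR -> mR).
  by apply: continuous_measurable_fun; exact: continuous_horner.
exact: measurableT_comp mp measurable_sqnorm.
Qed.

Lemma dotp_ge0 (x : R * R) : 0 <= dotp x x.
Proof. by rewrite addr_ge0// -expr2 sqr_ge0. Qed.

(* On each ray the integrand has the primitive [Q], so the bound on [Q] at the end of
   the ray integrates to a comparison with the disk of squared radius [c]. *)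
Lemma radial_integral_le (A : set (R * R)) (Q : {poly R}) (V b c : R) :
  measurable (A : set (mR * mR)) -> star_shaped A -> 0 <= V ->
  (forall x, A x -> dotp x x <= V) -> 0 <= b -> 0 <= c -> Q.[0] = 0 ->
  (forall v, 0 <= v <= V -> Q.[v] <= b * (c - v)) ->
  \int[area]_(x in A) Q^`().[dotp x x] <= b * (c * fine (area (sqdisk 1)) - fine (area A)).
Proof.
move=> mA starA V0 AV b0 c0 Q0 QV.
have Aoo : (area A < +oo)%E by apply: area_sqnorm_lty AV.
have Afin : area A \is a fin_num by rewrite ge0_fin_numE.
have [M M0 QM] := horner_bounded Q^`() V0.
pose W : {poly R} := Q + (b + M) *: 'X.
have dW v : W^`().[v] = Q^`().[v] + (b + M) by rewrite derivD derivZ derivX !hornerE.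
have dX v : (M *: 'X : {poly R})^`().[v] = M by rewrite derivZ derivX !hornerE.
have W0 v : 0 <= v <= V -> 0 <= W^`().[v].
  by move=> /QM; rewrite dW ler_norml => /andP[+ _]; lra.
have m1A : measurable_fun setT (\1_A : mR * mR -> mR) by exact: measurable_indic.
have m1D : measurable_fun setT (\1_(sqdisk c) : mR * mR -> mR).
  by apply: measurable_indic; exact: measurable_sqdisk.
have mM k f : measurable_fun setT (f : mR * mR -> mR) -> measurable_fun setT (fun z => (k * f z)%:E).
  by move=> mf; apply/measurable_EFinP; exact: measurable_scale_prod.
have key : (\int[area]_z (W^`().[dotp z z] * \1_A z)%:E <=
    \int[area]_z ((b * \1_(sqdisk c) z)%:E + (M * \1_A z)%:E))%E.
  apply: le_integral_slope.
  - apply/measurable_EFinP; apply: measurable_realfun.measurable_funM => //.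
    exact: measurable_horner_sqnorm.
  - move=> z; rewrite lee_fin indicE; have [/set_mem Az|] := boolP (z \in A); last by rewrite mulr0.
    by rewrite mulr1 W0// dotp_ge0 AV.
  - by apply: emeasurable_funD; exact: mM.
  - by move=> z; rewrite -EFinD lee_fin addr_ge0// mulr_ge0// indicE.
  move=> u; have k0 := @ray_coef_gt0 R u.
  rewrite (integral_ray u mA starA V0 AV W0).
  have -> : (\int[mu]_x (`|x|%:E * ((b * \1_(sqdisk c) (x, (x * u)%R))%:E + (M * \1_A (x, (x * u)%R))%:E)) =
      (b * c / (1 + u ^+ 2))%:E + (M * ray_len A u ^+ 2)%:E)%E.
    rewrite -(integral_ray_sqdisk u c0 b0).
    have -> : M * ray_len A u ^+ 2 =
        ((M *: 'X).[(1 + u ^+ 2) * ray_len A u ^+ 2] - (M *: 'X).[0]) / (1 + u ^+ 2).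
      apply: (mulIf (lt0r_neq0 k0)); rewrite divfK ?gt_eqF// !hornerZ !hornerX; ring.
    rewrite -(@integral_ray R A (M *: 'X) V u mA starA V0 AV); last by move=> v _; rewrite dX.
    rewrite -ge0_integralD//.
    - by apply: eq_integral => x _; rewrite dX -EFinD -!EFinM -EFinD mulrDr.
    - by move=> x _; rewrite -EFinM lee_fin !mulr_ge0// indicE.
    - exact: measurable_ray_fun (mM _ _ m1D).
    - by move=> x _; rewrite dX -EFinM lee_fin !mulr_ge0// indicE.
    - by under eq_fun do rewrite dX; exact: measurable_ray_fun (mM _ _ m1A).
  have r := ray_len_sqr_le u V0 AV.
  rewrite -EFinD lee_fin ler_pdivrMr//.
  have -> : (b * c / (1 + u ^+ 2) + M * ray_len A u ^+ 2) * (1 + u ^+ 2) =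
      b * c + M * ((1 + u ^+ 2) * ray_len A u ^+ 2) by field; rewrite gt_eqF.
  have v0 : 0 <= (1 + u ^+ 2) * ray_len A u ^+ 2 by rewrite mulr_ge0 ?sqr_ge0// ltW.
  have := QV ((1 + u ^+ 2) * ray_len A u ^+ 2); rewrite r v0 => /(_ isT).
  by rewrite !hornerD !hornerZ !hornerX Q0; lra.
have iQ : area.-integrable A (EFin \o (fun z => Q^`().[dotp z z])).
  apply: (@integrable_bounded _ _ M) => //; first exact: measurable_horner_sqnorm.
  by move=> x Ax; apply: QM; rewrite dotp_ge0 AV.
have i1 k : area.-integrable A (EFin \o (fun=> k)) by exact: (@integrable_bounded _ _ `|k|).
have Sfin := @area_sqdisk_fin R.
have eL : (\int[area]_z (W^`().[dotp z z] * \1_A z)%:E =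
    (\int[area]_(z in A) Q^`().[dotp z z] + (b + M) * fine (area A))%:E)%E.
  transitivity (\int[area]_(z in A) ((Q^`().[dotp z z])%:E + (b + M)%:E))%E.
    rewrite [RHS]integral_mkcond; apply: eq_integral => z _.
    by rewrite patchE indicE dW; case: ifP => _; rewrite ?mulr1 ?mulr0.
  rewrite (integralD mA iQ (i1 (b + M))) integral_cst// [RHS]EFinD [in RHS]EFinM (fineK Afin).
  by congr (_ + _)%E; rewrite /Rintegral fineK//; exact: integrable_fin_num iQ.
have eI k X : 0 <= k -> measurable (X : set (mR * mR)) ->
    (\int[area]_z (k * \1_X z)%:E = k%:E * area X)%E.
  move=> k_ge0 mX; under eq_integral do rewrite EFinM.
  rewrite ge0_integralZl//; first by rewrite integral_indic// setIT.
  by apply/measurable_EFinP; exact: measurable_indic.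
have eR : (\int[area]_z ((b * \1_(sqdisk c) z)%:E + (M * \1_A z)%:E) =
    (b * (c * fine (area (sqdisk 1))) + M * fine (area A))%:E)%E.
  rewrite ge0_integralD//.
  - rewrite !eI//; last exact: measurable_sqdisk.
    by rewrite area_sqdiskM// EFinD !EFinM !fineK.
  - by move=> z _; rewrite lee_fin mulr_ge0// indicE.
  - exact: mM.
  - by move=> z _; rewrite lee_fin mulr_ge0// indicE.
  - exact: mM.
by move: key; rewrite eL eR lee_fin; lra.
Qed.

End RadialBound.

(** * Exchange of bounded integrals over sets of finite measure *)

Section BoundedFubini.
Context {d1 d2} {T1 : measurableType d1} {T2 : measurableType d2} {R : realType}.
Variables (m1 : {sigma_finite_measure set T1 -> \bar R}) (m2 : {sigma_finite_measure set T2 -> \bar R}).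

(** The spaces are abstract because [circle_average_le] applies this to the circle and the plane in
    both orders; the integrability of the inner integral feeds [le_Rintegral]. *)
Lemma bounded_Fubini (A : set T1) (B : set T2) (g : T1 * T2 -> R) (M : R) :
  measurable A -> measurable B -> (m1 A < +oo)%E -> (m2 B < +oo)%E ->
  measurable_fun setT g -> (forall z, `|g z| <= M) ->
  m1.-integrable A (EFin \o (fun x => \int[m2]_(y in B) g (x, y))) /\
      \int[m1]_(x in A) \int[m2]_(y in B) g (x, y) =
      \int[m2]_(y in B) \int[m1]_(x in A) g (x, y).
Proof.
move=> mA mB Aoo Boo mg gM.
have bounded_int d (T : measurableType d) (m : {measure set T -> \bar R}) (D : set T) (h : T -> R) :
    measurable D -> (m D < +oo)%E -> measurable_fun setT h -> (forall z, `|h z| <= M) ->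
    m.-integrable D (EFin \o h).
  move=> mD Doo mh hM; apply: measurable_bounded_integrable => //.
    exact: measurable_funTS mh.
  exists M; split; first exact: num_real.
  by move=> N MN x _; exact: le_trans (hM x) (ltW MN).
pose F := (EFin \o g) \_ (A `*` B).
have iF : (m1 \x m2)%E.-integrable setT F.
  apply/(integrable_mkcond _ _).1; first exact: measurableX.
  apply: bounded_int => //; first exact: measurableX.
  by rewrite /= product_measure1E// lte_mul_pinfty// ge0_fin_numE.
have FE x : fubini_F m2 F x = ((EFin \o (fun x => \int[m2]_(y in B) g (x, y))) \_ A) x.
  rewrite /fubini_F patchE; case: ifPn => [xA|xA].
    have i2 : m2.-integrable B (EFin \o (fun y => g (x, y))).
      by apply: bounded_int => //; exact: measurableT_comp mg (pair1_measurable x).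
    rewrite /= /Rintegral fineK; last exact: integrable_fin_num i2.
    rewrite [RHS]integral_mkcond; apply: eq_integral => y _.
    by rewrite /F !patchE in_setX xA.
  by apply: integral0_eq => y _; rewrite /F patchE in_setX (negbTE xA).
have GE y : fubini_G m1 F y = ((EFin \o (fun y => \int[m1]_(x in A) g (x, y))) \_ B) y.
  rewrite /fubini_G patchE; case: ifPn => [yB|yB].
    have i1 : m1.-integrable A (EFin \o (fun x => g (x, y))).
      by apply: bounded_int => //; exact: measurableT_comp mg (pair2_measurable y).
    rewrite /= /Rintegral fineK; last exact: integrable_fin_num i1.
    rewrite [RHS]integral_mkcond; apply: eq_integral => x _.
    by rewrite /F !patchE in_setX yB andbT.
  by apply: integral0_eq => x _; rewrite /F patchE in_setX (negbTE yB) andbF.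
split.
  apply/(integrable_mkcond _ _).2 => //.
  by rewrite -(funext FE); exact: integrable_fubini_F.
rewrite /Rintegral; congr fine.
rewrite integral_mkcond [RHS]integral_mkcond.
rewrite -(funext FE) -(funext GE); exact: Fubini.
Qed.

End BoundedFubini.

(** * Averages over the circle of directions *)

Section CircleAverage.
Context {R : realType}.
Local Notation mR := (measurableTypeR R).
Local Notation mu := (@lebesgue_measure R).
Local Notation area := (@area R).

Lemma sigma_finite_area : sigma_finite setT area.
Proof.
exists (fun n => `]- n%:R, n%:R[ `*` `]- n%:R, n%:R[).
  apply/seteqP; split => // -[x y] _.
  have hx := archi_boundP (normr_ge0 x); have hy := archi_boundP (normr_ge0 y).
  pose n := (Num.bound `|x| + Num.bound `|y|)%N.
  exists n => //; split => /=; rewrite in_itv/= -ltr_norml.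
    by rewrite (lt_le_trans hx)// ler_nat leq_addr.
  by rewrite (lt_le_trans hy)// ler_nat leq_addl.
move=> n; have mi : measurable (`]- n%:R, n%:R[ `*` `]- n%:R, n%:R[ : set (mR * mR)).
  by apply: measurableX; exact: measurable_itv.
split => //; apply: (@area_box_lty _ _ n%:R) => // x [/=]; rewrite !in_itv/= -!ltr_norml.
by move=> /ltW ? /ltW ?.
Qed.

(* A bare copy of [area] that can carry a sigma-finite structure. *)
Definition plane_measure : set (mR * mR)%type -> \bar R := area.
HB.instance Definition _ := Measure.copy plane_measure (mu \x mu)%E.
HB.instance Definition _ := Measure_isSigmaFinite.Build _ _ _ plane_measure sigma_finite_area.

Local Notation circle := (`[0, 2 * pi]%classic : set R).

Lemma continuous_of_derive (f : R -> R) (t df : R) : is_derive t 1 f df -> {for t, continuous f}.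
Proof. by move=> [D _]; apply/differentiable_continuous/derivable1_diffP. Qed.

Definition dir (t : R) : R * R := (cos t, sin t).

Lemma is_derive_dotp_dir (y : R * R) (t : R) :
  is_derive t 1 (fun t => dotp (dir t) y) (cos t * y.2 - sin t * y.1).
Proof.
rewrite /dotp /dir/=.
have -> : cos t * y.2 - sin t * y.1 = y.1 *: - sin t + y.2 *: cos t.
  by rewrite /GRing.scale/=; ring.
have -> : (fun t => cos t * y.1 + sin t * y.2) = y.1 \*: cos + y.2 \*: sin.
  by apply/funext => u; rewrite /= ![_ * _.1]mulrC ![_ * _.2]mulrC.
exact: is_deriveD.
Qed.

(** The mean of the power 2 * k of the cosine over a period. *)
Definition wallis k : R := \prod_(i < k) ((2 * i).+1%:R / (2 * i).+2%:R).

Lemma measure_circle : (mu circle = (2 * pi)%:E)%E.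
Proof.
have := @lebesgue_measure_itv R `[0, 2 * pi]; rewrite /= lte_fin.
by rewrite mulr_gt0 ?pi_gt0// oppr0 adde0.
Qed.

(** With a the inner product and b its derivative, b' = - a and a ^ 2 + b ^ 2 = |y| ^ 2. The
    derivative of a ^ (2 * k + 1) * b has integral zero over a period, which is the recurrence
    between consecutive even moments. *)
Lemma circle_moment (y : R * R) k :
  \int[mu]_(t in circle) (dotp (dir t) y) ^+ (2 * k) = 2 * pi * wallis k * dotp y y ^+ k.
Proof.
pose a t := dotp (dir t) y; pose b t := cos t * y.2 - sin t * y.1.
have abE t : a t ^+ 2 + b t ^+ 2 = dotp y y.
  rewrite /a /b /dotp/=; transitivity ((cos t ^+ 2 + sin t ^+ 2) * (y.1 * y.1 + y.2 * y.2)).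
    by ring.
  by rewrite cos2Dsin2 mul1r.
have da (t : R) : is_derive t 1 a (b t) := is_derive_dotp_dir y t.
have db (t : R) : is_derive t 1 b (- a t).
  have -> : b = (fun t => dotp (dir t) (y.2, - y.1)).
    by apply/funext => u; rewrite /b /dotp/= mulrN.
  have -> : - a t = cos t * (y.2, - y.1).2 - sin t * (y.2, - y.1).1.
    by rewrite /a /dotp/=; ring.
  exact: is_derive_dotp_dir.
have ca : continuous a by move=> t; exact: continuous_of_derive (da t).
have cX n : continuous (fun t => a t ^+ n).
  by move=> t; apply: (@continuous_comp _ _ _ a (fun u => u ^+ n)); [exact: ca|exact: exprn_continuous].
have iC (h : R -> R) : continuous h -> mu.-integrable circle (EFin \o h).
  move=> ch; apply: continuous_compact_integrable; first exact: segment_compact.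
  exact: continuous_subspaceT.
have cZ c n : continuous (fun t => c * a t ^+ n).
  by move=> t; apply: cvgM; [exact: cvg_cst|exact: cX].
have mc : measurable (circle : set mR) by exact: measurable_itv.
have pi0 : 0 <= 2 * pi :> R by rewrite mulr_ge0// pi_ge0.
elim: k => [|k ih].
  rewrite /wallis big_ord0 muln0 !expr0 !mulr1.
  under eq_Rintegral do rewrite expr0.
  by transitivity (1 * fine (mu circle)); [exact: Rintegral_cst|rewrite measure_circle mul1r].
pose F := (a ^+ (2 * k).+1) * b.
pose f t := (2 * k).+1%:R * dotp y y * a t ^+ (2 * k) - (2 * k).+2%:R * a t ^+ (2 * k).+2.
have dF (t : R) : is_derive t 1 F (f t).
  have -> : f t = (a ^+ (2 * k).+1) t *: (- a t) + b t *: (((2 * k).+1%:R * a t ^+ (2 * k)) *: b t).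
    rewrite /f -(abE t) exprfctE /GRing.scale/= !exprS -[(2 * k).+2%:R]natr1.
    ring.
  exact: is_deriveM.
have cf : continuous f.
  by move=> t; apply: cvgB; exact: cZ.
have := integral_deriv pi0 dF cf.
have -> : F (2 * pi) - F 0 = 0.
  have [c2 s2] : cos (2 * pi) = 1 :> R /\ sin (2 * pi) = 0 :> R.
    by rewrite mulrC mulr_natr cos2pi sin2pi.
  by rewrite /F !fctE /a /b /dotp /dir/= c2 s2 cos0 sin0 subrr.
move=> F0; have : \int[mu]_(t in circle) f t = 0 by rewrite /Rintegral F0.
rewrite RintegralB//; try by apply: iC; exact: cZ.
rewrite !RintegralZl//; try by apply: iC; exact: cX.
rewrite ih => /eqP; rewrite subr_eq0 => /eqP e.
rewrite mulnS; apply: (@mulfI _ (2 * k).+2%:R); first by rewrite pnatr_eq0.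
rewrite -e /wallis big_ord_recr/= exprS.
have := @pnatr_eq0 R (2 * k).+2; set n2 := (2 * k).+2%:R => /negbT n20.
by field.
Qed.

(** This takes Taylor polynomials of the cosine, in the squared variable, to those of J_0. *)
Definition circle_avg (p : {poly R}) : {poly R} := \sum_(k < size p) (p`_k * wallis k) *: 'X^k.

Lemma continuous_dotp_dir (y : R * R) : continuous (fun t => dotp (dir t) y).
Proof. by move=> t; exact: continuous_of_derive (is_derive_dotp_dir y t). Qed.

Lemma Rintegral_circle_avg (p : {poly R}) (y : R * R) :
  \int[mu]_(t in circle) p.[dotp (dir t) y ^+ 2] = 2 * pi * (circle_avg p).[dotp y y].
Proof.
have mc : measurable (circle : set mR) by exact: measurable_itv.
have iC (h : R -> R) : continuous h -> mu.-integrable circle (EFin \o h).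
  move=> ch; apply: continuous_compact_integrable; first exact: segment_compact.
  exact: continuous_subspaceT.
have cX n : continuous (fun t => dotp (dir t) y ^+ n).
  move=> t; apply: (@continuous_comp _ _ _ (fun t => dotp (dir t) y) (fun u => u ^+ n)).
    exact: continuous_dotp_dir.
  exact: exprn_continuous.
(* Truncations of [p]: the induction runs on their length while the coefficients stay those of
   [p]. *)
pose q n : {poly R} := \sum_(k < n) p`_k *: 'X^k.
have cq n : continuous (fun t => (q n).[dotp (dir t) y ^+ 2]).
  move=> t; apply: (@continuous_comp _ _ _ (fun t => dotp (dir t) y ^+ 2) (horner (q n))).
    exact: cX.
  exact: continuous_horner.
have -> : p = q (size p) by rewrite /q -[LHS]coefK poly_def.
rewrite /circle_avg; have -> : size (q (size p)) = size p.
  by rewrite /q -poly_def coefK.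
rewrite -[in X in _ = X](_ : p = q (size p)); last by rewrite /q -[LHS]coefK poly_def.
elim: (size p) => [|n ih].
  rewrite /q !big_ord0 horner0 mulr0; under eq_Rintegral do rewrite horner0.
  by rewrite Rintegral_cst// mul0r.
rewrite big_ord_recr/= hornerD hornerZ hornerXn.
have mD (u v w : R) : u * (v + w) = u * v + u * w by rewrite mulrDr.
rewrite [RHS]mD -ih.
have qS x : (q n.+1).[x ^+ 2] = (q n).[x ^+ 2] + p`_n * x ^+ (2 * n).
  by rewrite /q big_ord_recr/= hornerD hornerZ hornerXn -exprM.
transitivity (\int[mu]_(t in circle) ((q n).[dotp (dir t) y ^+ 2] + p`_n * dotp (dir t) y ^+ (2 * n))).
  by apply: eq_Rintegral => t _; exact: qS.
rewrite RintegralD//; last by apply: iC => t; apply: cvgM; [exact: cvg_cst|exact: cX].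
  by rewrite RintegralZl//; [rewrite circle_moment; congr (_ + _); ring|exact/iC/cX].
by apply: iC; exact: cq.
Qed.

Lemma measurable_dotp_dir : measurable_fun setT (fun z : mR * (mR * mR) => dotp (dir z.1) z.2 : mR).
Proof.
have mcs (h : R -> R) : continuous h -> measurable_fun setT (fun z : mR * (mR * mR) => h z.1 : mR).
  move=> ch; have mh : measurable_fun setT (h : mR -> mR) by exact: continuous_measurable_fun.
  exact: measurableT_comp mh measurable_fst.
apply: measurable_realfun.measurable_funD; apply: measurable_realfun.measurable_funM.
- by apply: mcs; exact: continuous_cos.
- exact: measurableT_comp measurable_fst measurable_snd.
- by apply: mcs; exact: continuous_sin.
- exact: measurableT_comp measurable_snd measurable_snd.
Qed.

(* Some direction does at most as well as the average over all directions. *)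
Lemma circle_average_le (A : set (R * R)) (f : R -> R) (p Q : {poly R}) (V b c m : R) :
  measurable (A : set (mR * mR)) -> star_shaped A -> 0 <= V ->
  (forall x, A x -> dotp x x <= V) -> 0 <= b -> 0 <= c ->
  continuous f -> (forall w, `|f w| <= 1) -> (forall w, f w <= p.[w ^+ 2]) ->
  Q.[0] = 0 -> Q^`() = circle_avg p ->
  (forall v, 0 <= v <= V -> Q.[v] <= b * (c - v)) ->
  (forall t, m <= \int[area]_(x in A) f (dotp (dir t) x)) ->
  m <= b * (c * fine (area (sqdisk 1)) - fine (area A)).
Proof.
move=> mA starA V0 AV b0 c0 cf f1 fp Q0 Q' QV mK.
have Aoo : (area A < +oo)%E by apply: area_sqnorm_lty AV.
have mc : measurable (circle : set mR) by exact: measurable_itv.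
have coo : (mu circle < +oo)%E by rewrite measure_circle ltry.
have mf : measurable_fun setT (f : mR -> mR) by exact: continuous_measurable_fun.
pose g (z : mR * (mR * mR)) : R := f (dotp (dir z.1) z.2).
have mg : measurable_fun setT g by exact: measurableT_comp mf measurable_dotp_dir.
have [iK swapK] := @bounded_Fubini _ _ mR (mR * mR)%type R mu plane_measure circle A g 1
  mc mA coo Aoo mg (fun z => f1 _).
have msw : measurable_fun setT (fun z : (mR * mR) * mR => (z.2, z.1) : mR * (mR * mR)).
  by apply/measurable_fun_pairP; split; [exact: measurable_snd|exact: measurable_fst].
pose gs (z : (mR * mR) * mR) := g (z.2, z.1).
have mgs : measurable_fun setT gs by exact: measurableT_comp mg msw.
(* The swapped order supplies integrability over [A] of the integral over the circle. *)
have [iL _] := @bounded_Fubini _ _ (mR * mR)%type mR R plane_measure mu A circle gs 1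
  mA mc Aoo coo mgs (fun z => f1 _).
have pi0 : 0 < 2 * pi :> R by rewrite mulr_gt0 ?pi_gt0.
rewrite -(ler_pM2l pi0).
apply: le_trans (ler_wpM2l (ltW pi0) (radial_integral_le mA starA V0 AV b0 c0 Q0 QV)).
have [M M0 QM] := horner_bounded Q^`() V0.
have iQ : area.-integrable A (EFin \o (fun z => Q^`().[dotp z z])).
  apply: (@integrable_bounded _ _ _ M) => //; first exact: measurable_horner_sqnorm.
  by move=> x Ax; apply: QM; rewrite dotp_ge0 AV.
rewrite -RintegralZl//.
(* The double integral is at least [2 * pi * m] by the bound in each direction; after the exchange,
   [f] is replaced by [p] and averaged at each point of [A]. *)
apply: (@le_trans _ _ (\int[mu]_(t in circle) \int[area]_(x in A) g (t, x))).
  have -> : 2 * pi * m = \int[mu]_(t in circle) m.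
    by transitivity (m * fine (mu circle)); [rewrite measure_circle mulrC|exact/esym/Rintegral_cst].
  apply: le_Rintegral => //; last by move=> t _; exact: mK.
  apply: continuous_compact_integrable; first exact: segment_compact.
  by apply: continuous_subspaceT; exact: cst_continuous.
rewrite [leLHS]swapK; apply: le_Rintegral => //.
  exact: (integrableZl mA (2 * pi) iQ).
move=> x Ax; rewrite Q' -Rintegral_circle_avg.
have iC (h : R -> R) : continuous h -> mu.-integrable circle (EFin \o h).
  move=> ch; apply: continuous_compact_integrable; first exact: segment_compact.
  exact: continuous_subspaceT.
have cd := @continuous_dotp_dir x.
apply: le_Rintegral => //.
- apply: iC => t; apply: (@continuous_comp _ _ _ (fun t => dotp (dir t) x) f); [exact: cd|exact: cf].
- apply: iC => t; apply: (@continuous_comp _ _ _ (fun t => dotp (dir t) x) (fun u => p.[u ^+ 2])).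
    exact: cd.
  apply: (@continuous_comp _ _ _ (fun u : R => u ^+ 2) (horner p)); first exact: exprn_continuous.
  exact: continuous_horner.
- by move=> t _; exact: fp.
Qed.

End CircleAverage.

(** * The transform of a balanced set and upper bounds for [kappa] *)

Section Kappa.
Context {R : realType}.
Local Notation mR := (measurableTypeR R).
Local Notation area := (@area R).
Implicit Types (A : set (R * R)) (x xi : R * R).

Lemma measurable_dotp xi : measurable_fun setT (dotp xi : mR * mR -> mR).
Proof.
by apply: measurable_realfun.measurable_funD; apply: measurable_scale_prod;
  [exact: measurable_fst|exact: measurable_snd].
Qed.

Lemma measurable_wave (f : R -> R) xi : continuous f ->
  measurable_fun setT (fun x : mR * mR => f (dotp xi x) : mR).
Proof.
move=> cf; have mf : measurable_fun setT (f : mR -> mR) by exact: continuous_measurable_fun.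
exact: measurableT_comp mf (measurable_dotp xi).
Qed.

Lemma Rintegral_rot c s A (f : R * R -> R) (B : R) : c ^+ 2 + s ^+ 2 = 1 ->
  measurable (A : set (mR * mR)) -> (area A < +oo)%E ->
  measurable_fun setT (f : mR * mR -> mR) -> (forall x, `|f x| <= B) ->
  \int[area]_(x in rot c s @^-1` A) f (rot c s x) = \int[area]_(x in A) f x.
Proof.
move=> cs mA Aoo mf fB; rewrite /Rintegral; congr fine.
have mr := @measurable_rot R c s.
have mrA := measurable_preimage mr mA.
have i1 : area.-integrable (rot c s @^-1` A) ((EFin \o f) \o rot c s).
  apply: (@integrable_bounded _ _ (f \o rot c s) B) => //.
  - by apply: le_lt_trans Aoo; rewrite -(area_rot cs mA).
  - exact: measurableT_comp mf mr.
  - by move=> x _; exact: fB.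
have := @integral_pushforward _ _ (mR * mR)%type (mR * mR)%type R (rot c s) mr area A (EFin \o f) _ i1 mA.
move=> <-; last exact/measurable_EFinP.
by apply: eq_measure_integral => X mX _; exact: area_rot.
Qed.

(** The half turn preserves [area] and [A], and changes the sign of the sine. *)
Lemma sin_balanced A xi : measurable (A : set (mR * mR)) -> (area A < +oo)%E ->
  balanced A -> \int[area]_(x in A) sin (dotp xi x) = 0.
Proof.
move=> mA Aoo bA.
have cs : (-1) ^+ 2 + 0 ^+ 2 = 1 :> R by rewrite sqrrN expr1n expr0n/= addr0.
have rE x : rot (-1) 0 x = - x.
  by case: x => a b; rewrite /rot/=; congr pair; rewrite !mul0r ?subr0 ?add0r mulN1r.
have AE : rot (-1) 0 @^-1` A = A.
  apply/seteqP; split => x /=; rewrite rE => Ax; last exact: bA.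
  by rewrite -[x]opprK; exact: bA.
have := @Rintegral_rot (-1) 0 A (fun x => sin (dotp xi x)) 1 cs mA Aoo
  (measurable_wave xi (@continuous_sin R)) (fun x => sin_max _).
rewrite AE.
have -> : \int[area]_(x in A) sin (dotp xi (rot (-1) 0 x)) = - \int[area]_(x in A) sin (dotp xi x).
  transitivity (\int[area]_(x in A) (-1 * sin (dotp xi x))).
    apply: eq_Rintegral => x _; rewrite rE mulN1r -sinN; congr sin.
    by rewrite /dotp/=; ring.
  rewrite RintegralZl ?mulN1r//.
  apply: (@integrable_bounded _ _ _ 1) => //.
    exact: measurable_wave (@continuous_sin R).
  by move=> x _; exact: sin_max.
by move=> /eqP; rewrite eqNr => /eqP.
Qed.

(* The transform is the positive area at the origin, so by continuity it vanishes on
   the segment from [0] to [xi]. *)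
Lemma kappa_le A xi : measurable (A : set (mR * mR)) -> (area A < +oo)%E ->
  balanced A -> \int[area]_(x in A) cos (dotp xi x) <= 0 -> (kappa A <= (enorm xi)%:E)%E.
Proof.
move=> mA Aoo bA le0.
pose h (t : R) := \int[area]_(x in A) cos (t * dotp xi x).
have wave t : \int[area]_(x in A) cos (dotp (t * xi.1, t * xi.2) x) = h t.
  by apply: eq_Rintegral => x _; congr cos; rewrite /dotp/=; ring.
have iw (t : R) : area.-integrable A (EFin \o (fun x => cos (t * dotp xi x))).
  apply: (@integrable_bounded _ _ _ 1) => //.
    exact: (measurable_wave xi (@continuous_cos_scaled R t)).
  by move=> x _; exact: cos_max.
have ct (y : R) : continuous (fun u : R => cos (u * y)).
  by under eq_fun do rewrite mulrC; exact: continuous_cos_scaled.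
(* Continuity under the integral is stated on an open interval, so one containing [0, 1] is
   taken. *)
have ch : {in `](-1), 2[%classic, continuous h}.
  apply: (@continuity_under_integral R _ (mR * mR)%type area (fun t x => cos (t * dotp xi x))
    A mA (-1) 2 _ _ (fun=> 1)).
  - by move=> t _; exact: iw.
  - by apply: aeW => y _ t _; exact: ct.
  - by apply: (@integrable_bounded _ _ _ `|1|).
  - by move=> t _; apply: aeW => y _; exact: cos_max.
have [t] : exists2 t : R, t \in `[0, 1] & h t = 0.
  apply: IVT => //.
    apply: continuous_in_subspaceT => t /set_mem/=; rewrite in_itv/= => /andP[t0 t1].
    by apply: ch; rewrite inE/= in_itv/=; apply/andP; lra.
  have h1 : h 1 <= 0.
    by move: le0; rewrite [X in X <= _ -> _](_ : _ = h 1)//; apply: eq_Rintegral => x _; rewrite mul1r.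
  have h0 : 0 <= h 0 by apply: Rintegral_ge0 => x _; rewrite mul0r cos0.
  by rewrite ge_min h1 orbT le_max h0.
rewrite in_itv/= => /andP[t0 t1] ht0.
apply: (@le_trans _ _ (enorm (t * xi.1, t * xi.2))%:E).
  apply: ereal_inf_lbound; exists (t * xi.1, t * xi.2) => //.
  by rewrite /real_null_set/= /fourier_ind wave ht0 sin_balanced.
rewrite lee_fin /enorm.
have -> : dotp (t * xi.1, t * xi.2) (t * xi.1, t * xi.2) = t ^+ 2 * dotp xi xi.
  by rewrite /dotp/=; ring.
by rewrite sqrtrM ?sqr_ge0// sqrtr_sqr ger0_norm// ler_piMl// sqrtr_ge0.
Qed.

End Kappa.

(** * The cosine of period [h] against affine functions of the absolute value *)

Section CosAffine.
Context {R : realType}.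
Local Notation mR := (measurableTypeR R).
Local Notation mu := (@lebesgue_measure R).

Lemma continuous_cos_affine_abs (a p d q : R) :
  continuous (fun t : R => cos (a * t) * (p + d * (`|t| - q))).
Proof.
move=> t; apply: cvgM; first exact: continuous_cos_scaled.
apply: cvgD; first exact: cvg_cst.
apply: cvgM; first exact: cvg_cst.
by apply: cvgB; [exact: norm_continuous|exact: cvg_cst].
Qed.

Lemma integrable_cos_affine_abs (h a p d q : R) :
  mu.-integrable `]- h, h[ (EFin \o (fun t : R => cos (a * t) * (p + d * (`|t| - q)))).
Proof.
have ik : mu.-integrable `[- h, h] (EFin \o (fun t : R => cos (a * t) * (p + d * (`|t| - q)))).
  apply: continuous_compact_integrable; first exact: segment_compact.
  by apply: continuous_subspaceT; exact: continuous_cos_affine_abs.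
apply: integrableS ik => //.
by move=> t; rewrite /= !in_itv/= => /andP[/ltW -> /ltW ->].
Qed.

(** On [0, h] the primitive [G] has equal values at the two ends, since the sine vanishes and the
    cosine is 1 at both; the other half follows by reflection. This is the comparison value for the
    section lengths. *)
Lemma Rintegral_cos_affine_abs (h p d q : R) : 0 < h ->
  \int[mu]_(t in `]- h, h[) (cos (2 * pi / h * t) * (p + d * (`|t| - q))) = 0.
Proof.
move=> h0; pose a := 2 * pi / h; pose k t := cos (a * t) * (p + d * (`|t| - q)).
have a0 : 0 < a by rewrite divr_gt0// mulr_gt0// pi_gt0.
have ck : continuous k := @continuous_cos_affine_abs _ _ _ _.
have ik : mu.-integrable `[- h, h] (EFin \o k).
  apply: continuous_compact_integrable; first exact: segment_compact.
  exact: continuous_subspaceT.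
have ikS I : measurable (I : set mR) -> I `<=` `[- h, h] -> mu.-integrable I (EFin \o k).
  by move=> mI Ih; apply: integrableS ik => //; exact: measurable_itv.
pose G s := (p + d * (s - q)) * sin (a * s) / a + d * cos (a * s) / a ^+ 2.
have dG (s : R) : is_derive s 1 G (cos (a * s) * (p + d * (s - q))).
  have dl : is_derive s 1 ( *%R a) a.
    by apply: is_derive_eq; rewrite /GRing.scale/= mulr1.
  have ds : is_derive s 1 (sin \o *%R a) (a * cos (a * s)).
    by apply: is_derive_eq; rewrite /GRing.scale/= mulrC.
  have dc : is_derive s 1 (cos \o *%R a) (- (a * sin (a * s))).
    by apply: is_derive_eq; rewrite /GRing.scale/=; ring.
  pose P : {poly R} := p%:P + d *: ('X - q%:P).
  have PE u : P.[u] = p + d * (u - q) by rewrite /P !hornerE.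
  have dP : is_derive s 1 (horner P) d.
    have <- : P^`().[s] = d.
      rewrite /P derivD derivC derivZ derivB derivX derivC.
      by rewrite !(hornerD, hornerN, hornerZ, hornerC); ring.
    exact: is_derive_poly.
  have -> : G = a^-1 \*: (horner P * (sin \o *%R a)) + (d / a ^+ 2) \*: (cos \o *%R a).
    by apply/funext => u; rewrite !fctE /= PE /G /GRing.scale/=; ring.
  have -> : cos (a * s) * (p + d * (s - q)) =
      a^-1 *: (P.[s] *: (a * cos (a * s)) + sin (a * s) *: d) + (d / a ^+ 2) *: (- (a * sin (a * s))).
    by rewrite PE /GRing.scale/=; field; rewrite gt_eqF.
  by apply: is_deriveD; apply: is_deriveZ; apply: is_deriveM.
have GE : G h = G 0.
  have [c2 s2] : cos (2 * pi) = 1 :> R /\ sin (2 * pi) = 0 :> R.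
    by rewrite mulrC mulr_natr cos2pi sin2pi.
  by rewrite /G mulr0 sin0 cos0 /a divfK ?gt_eqF// c2 s2 !mulr0 !mul0r.
have I1 : \int[mu]_(t in `[0, h]) k t = 0.
  transitivity (\int[mu]_(t in `[0, h]) (cos (a * t) * (p + d * (t - q)))).
    by apply: eq_Rintegral => t; rewrite inE/= in_itv/= => /andP[t0 _]; rewrite /k ger0_norm.
  rewrite /Rintegral (integral_deriv (ltW h0) dG) ?GE ?subrr//.
  move=> t; apply: cvgM; first exact: continuous_cos_scaled.
  apply: cvgD; first exact: cvg_cst.
  by apply: cvgM; [exact: cvg_cst|apply: cvgB; [exact: cvg_id|exact: cvg_cst]].
have I2 : \int[mu]_(t in `[- h, 0]) k t = 0.
  rewrite -[RHS]I1 /Rintegral -[X in `[_, X]]oppr0 integration_by_substitution_oppr; last 2 first.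
  - exact: ltW.
  - by apply: continuous_subspaceT; exact: ck.
  congr fine; apply: eq_integral => t _.
  by rewrite /= /k normrN mulrN cosN.
have hh : - h < h by lra.
transitivity (\int[mu]_(t in `[- h, h]) k t).
  rewrite Rintegral_itv_obnd_cbnd; last first.
    by apply: ikS => [|t]; [exact: measurable_itv|rewrite /= !in_itv/= => /andP[? ?]; apply/andP; lra].
  rewrite Rintegral_itv_bndo_bndc//.
  by apply: ikS => [|t]; [exact: measurable_itv|rewrite /= !in_itv/= => /andP[? ?]; apply/andP; lra].
have := @Rintegral_itvB R k (BLeft (- h)) (BRight h) 0 ik.
rewrite !bnd_simp I2 subr0 Rintegral_itv_obnd_cbnd ?I1; last first.
  by apply: ikS => [|t]; [exact: measurable_itv|rewrite /= !in_itv/= => /andP[? ?]; apply/andP; lra].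
by apply; rewrite ?oppr_le0 ltW.
Qed.

End CosAffine.

(** * Section lengths of a convex balanced set *)

Section Sections.
Context {R : realType}.
Local Notation mR := (measurableTypeR R).
Local Notation mu := (@lebesgue_measure R).
Local Notation area := (@area R).

Lemma lebesgue_measure_interval (I : set R) : is_interval I -> has_sup I -> has_inf I ->
  mu I = (sup I - inf I)%:E.
Proof.
move=> itvI supI infI.
have [x Ix] : I !=set0 by case: supI.
have ge_infI y : I y -> inf I <= y by move=> Iy; apply: ge_inf => //; case: infI.
have le_supI y : I y -> y <= sup I by move=> Iy; apply: ub_le_sup => //; case: supI.
have le : inf I <= sup I := le_trans (ge_infI x Ix) (le_supI x Ix).
have eq_sup : sup I <= inf I -> sup I = inf I by move=> ge; apply/eqP; rewrite eq_le ge le.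
have mI : measurable (I : set mR) by exact: is_interval_measurable.
apply/eqP; rewrite eq_le; apply/andP; split.
  have -> : (sup I - inf I)%:E = mu `[inf I, sup I]%classic.
    by rewrite lebesgue_measure_itv/= lte_fin; case: ltP => // /eq_sup ->; rewrite subrr.
  apply: le_measure; rewrite ?inE//.
  by move=> y Iy; rewrite /= in_itv/= ge_infI// le_supI.
have -> : (sup I - inf I)%:E = mu `]inf I, sup I[%classic.
  by rewrite lebesgue_measure_itv/= lte_fin; case: ltP => // /eq_sup ->; rewrite subrr.
apply: le_measure; rewrite ?inE//.
move=> y; rewrite /= in_itv/= => /andP[iy ys].
have [u Iu uy] := inf_lt infI.1 iy; have [v Iv yv] := sup_gt supI.1 ys.
by apply: (itvI u v) => //; rewrite !ltW.
Qed.

Lemma sup_add_le (A B : set R) (a b g : R) : A !=set0 -> B !=set0 -> 0 < a -> 0 < b ->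
  (forall x y, A x -> B y -> a * x + b * y <= g) -> a * sup A + b * sup B <= g.
Proof.
move=> A0 B0 a0 b0 H.
have sB x : A x -> a * x + b * sup B <= g.
  move=> Ax; have : sup B <= (g - a * x) / b.
    by apply: ge_sup => // y By; rewrite ler_pdivlMr//; have := H _ _ Ax By; lra.
  by rewrite ler_pdivlMr//; lra.
have : sup A <= (g - b * sup B) / a.
  by apply: ge_sup => // x Ax; rewrite ler_pdivlMr//; have := sB _ Ax; lra.
by rewrite ler_pdivlMr//; lra.
Qed.

Lemma inf_add_ge (A B : set R) (a b g : R) : A !=set0 -> B !=set0 -> 0 < a -> 0 < b ->
  (forall x y, A x -> B y -> g <= a * x + b * y) -> g <= a * inf A + b * inf B.
Proof.
move=> A0 B0 a0 b0 H.
have sB x : A x -> g <= a * x + b * inf B.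
  move=> Ax; have : (g - a * x) / b <= inf B.
    by apply: lb_le_inf => // y By; rewrite ler_pdivrMr//; have := H _ _ Ax By; lra.
  by rewrite ler_pdivrMr//; lra.
have : (g - b * inf B) / a <= inf A.
  by apply: lb_le_inf => // x Ax; rewrite ler_pdivrMr//; have := sB _ Ax; lra.
by rewrite ler_pdivrMr//; lra.
Qed.

Definition convex_plane (B : set (R * R)) := forall x y (t : R), B x -> B y -> 0 <= t <= 1 ->
  B ((1 - t) * x.1 + t * y.1, (1 - t) * x.2 + t * y.2).

Section SectionLength.
Variables (B : set (R * R)) (M h : R).
Hypotheses (mB : measurable (B : set (mR * mR))) (cB : convex_plane B) (bB : balanced B).
Hypotheses (BM : forall x, B x -> `|x.2| <= M) (h0 : 0 < h).
Hypotheses (Bh : forall x, B x -> `|x.1| < h) (Bsup : forall s, s < h -> exists2 x, B x & s < x.1).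

Let S t := xsection B t.
Definition section_length t := fine (mu (S t)).

Let SE t y : S t y <-> B (t, y).
Proof. by rewrite /S /xsection/= inE. Qed.

Lemma convex_balanced_star : star_shaped B.
Proof.
(* [t] times [x] is the convex combination of [x] and [- x] with weights [1 - u] and [u]. *)
move=> x t Bx t1; pose u := (1 - t) / 2.
have u01 : 0 <= u <= 1 by move: t1; rewrite ler_norml /u => /andP[? ?]; apply/andP; lra.
by have := cB Bx (bB Bx) u01; congr B; rewrite /= /u; congr pair; field.
Qed.

Lemma section_nonempty t : `|t| < h -> S t !=set0.
Proof.
move=> /Bsup[x Bx tx]; have x0 : 0 < x.1 by rewrite (le_lt_trans _ tx).
exists (t / x.1 * x.2); apply/SE.
have := @convex_balanced_star x (t / x.1) Bx; rewrite divfK ?gt_eqF//; apply.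
by rewrite normf_div (gtr0_norm x0) ler_pdivrMr// mul1r ltW.
Qed.

Lemma section_interval t : is_interval (S t).
Proof.
move=> y z /SE By /SE Bz w /andP[yw wz]; apply/SE.
have [yz|zy] := ltP y z; last by have -> : w = y by apply/eqP; rewrite eq_le yw (le_trans wz).
have d0 : 0 < z - y by rewrite subr_gt0.
have u01 : 0 <= (w - y) / (z - y) <= 1.
  by rewrite divr_ge0 ?subr_ge0 ?(ltW yz)//= ler_pdivrMr// mul1r lerD2r.
by have := cB By Bz u01; congr B; rewrite /=; congr pair; field; rewrite gt_eqF.
Qed.

Lemma section_bounds t : `|t| < h -> has_sup (S t) /\ has_inf (S t).
Proof.
move=> /section_nonempty ne; split; split => //.
  by exists M => y /SE /BM/=; rewrite ler_norml => /andP[].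
by exists (- M) => y /SE /BM/=; rewrite ler_norml => /andP[].
Qed.

Lemma section_lengthE t : `|t| < h -> section_length t = sup (S t) - inf (S t).
Proof.
move=> /section_bounds[supS infS].
by rewrite /section_length lebesgue_measure_interval//; exact: section_interval.
Qed.

(** Brunn-Minkowski in dimension one: the section at [q] contains the weighted combinations of the
    sections at [p] and [r], so its supremum is at least, and its infimum at most, the combined
    one. *)
Lemma section_length_concave (p q r : R) : `|p| < h -> `|r| < h -> p < q < r ->
  (r - q) * section_length p + (q - p) * section_length r <= (r - p) * section_length q.
Proof.
move=> ph rh /andP[pq qr].
have qh : `|q| < h.
  by move: ph rh; rewrite !ltr_norml => /andP[? ?] /andP[? ?]; apply/andP; lra.
have rp : 0 < r - p by lra.
have comb y z : S p y -> S r z -> S q (((r - q) * y + (q - p) * z) / (r - p)).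
  move=> /SE By /SE Bz; apply/SE.
  have u01 : 0 <= (q - p) / (r - p) <= 1.
    by rewrite ler_pdivlMr// ler_pdivrMr//; apply/andP; lra.
  by have := cB By Bz u01; congr B; rewrite /=; congr pair; field; rewrite gt_eqF.
rewrite !section_lengthE//.
have [sq iq] := section_bounds qh.
have np := section_nonempty ph; have nr := section_nonempty rh.
have qr0 : 0 < r - q by lra.
have qp0 : 0 < q - p by lra.
have := @sup_add_le _ _ _ _ ((r - p) * sup (S q)) np nr qr0 qp0.
have := @inf_add_ge _ _ _ _ ((r - p) * inf (S q)) np nr qr0 qp0.
move=> /(_ _) i /(_ _) s.
have {}i : (r - p) * inf (S q) <= (r - q) * inf (S p) + (q - p) * inf (S r).
  apply: i => y z Sy Sz; rewrite mulrC -ler_pdivlMr//; apply: ge_inf; first by case: iq.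
  exact: comb.
have {}s : (r - q) * sup (S p) + (q - p) * sup (S r) <= (r - p) * sup (S q).
  apply: s => y z Sy Sz; rewrite [leRHS]mulrC -ler_pdivrMr//; apply: ub_le_sup; first by case: sq.
  exact: comb.
lra.
Qed.

Lemma section_lengthN (t : R) : section_length (- t) = section_length t.
Proof.
rewrite /section_length -[in RHS]lebesgue_measureN; last exact: measurable_xsection.
congr (fine (mu _)); apply/seteqP; split => y /=.
  by move=> /SE By; apply/SE; have := bB By; congr B; congr pair; exact: opprK.
by move=> /SE By; apply/SE; have := bB By; congr B; congr pair; exact: opprK.
Qed.

(* [chord] interpolates the section length at [h / 4] and [3 h / 4]; the cosine changes
   sign exactly there, so concavity gives the inequality below on each interval. *)
Let D := (section_length (3 * h / 4) - section_length (h / 4)) / (h / 2).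
Let chord s := section_length (h / 4) + D * (s - h / 4).

Lemma cos_section_length_le (t : R) : `|t| < h ->
  cos (2 * pi / h * t) * section_length t <= cos (2 * pi / h * t) * chord `|t|.
Proof.
wlog t0 : t / 0 <= t => [H th|].
  have [/H|t0] := leP 0 t; first exact.
  have := H (- t); rewrite normrN mulrN cosN section_lengthN; apply => //.
  by rewrite oppr_ge0 ltW.
rewrite ger0_norm// => th.
have h4 : `|h / 4| < h by rewrite gtr0_norm; lra.
have h34 : `|3 * h / 4| < h by rewrite gtr0_norm; lra.
have th' : `|t| < h by rewrite ger0_norm.
have chordE s : chord s * (h / 2) =
    (3 * h / 4 - s) * section_length (h / 4) + (s - h / 4) * section_length (3 * h / 4).
  by rewrite /chord /D; field; rewrite gt_eqF.
have h2 : 0 < h / 2 by lra.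
have pi0 : 0 < pi :> R := pi_gt0 R.
pose a := 2 * pi / h * t; rewrite -/a.
have aE : a = 2 * pi * (t / h) by rewrite /a mulrAC -mulrA.
have a_le s : t <= s * h -> a <= 2 * pi * s.
  by move=> ts; rewrite aE ler_pM2l ?mulr_gt0// ler_pdivrMr.
have a_ge s : s * h <= t -> 2 * pi * s <= a.
  by move=> ts; rewrite aE ler_pM2l ?mulr_gt0// ler_pdivlMr.
have a0 : 0 <= a by have := a_ge 0; rewrite mul0r mulr0; apply.
have [t1|t1] := ltP t (h / 4).
  have a1 : a <= 2 * pi * (1 / 4) by apply: a_le; lra.
  rewrite ler_wpM2l ?cos_ge0_pihalf//; first by apply/andP; lra.
  rewrite -(ler_pM2r h2) chordE.
  have pqr : t < h / 4 < 3 * h / 4 by apply/andP; lra.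
  have := section_length_concave th' h34 pqr; lra.
have [t3|t3] := ltP (3 * h / 4) t.
  have a3 : 2 * pi * (3 / 4) <= a by apply: a_ge; lra.
  have a4 : a <= 2 * pi * 1 by apply: a_le; lra.
  rewrite ler_wpM2l//.
    have -> : cos a = cos (2 * pi - a).
      by rewrite -[RHS]cosN opprB -[RHS]cosD2pi; congr cos; rewrite -mulr_natl; ring.
    by apply: cos_ge0_pihalf; apply/andP; lra.
  rewrite -(ler_pM2r h2) chordE.
  have pqr : h / 4 < 3 * h / 4 < t by apply/andP; lra.
  have := section_length_concave h4 th' pqr; lra.
have a1 : 2 * pi * (1 / 4) <= a by apply: a_ge; lra.
have a3 : a <= 2 * pi * (3 / 4) by apply: a_le; lra.
rewrite ler_wnM2l//.
  have -> : cos a = - cos (a - pi) by rewrite -cosDpi subrK.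
  by rewrite oppr_le0; apply: cos_ge0_pihalf; apply/andP; lra.
rewrite -(ler_pM2r h2) chordE.
have [->|n1] := eqVneq t (h / 4); first lra.
have [->|n3] := eqVneq t (3 * h / 4); first lra.
have pqr : h / 4 < t < 3 * h / 4 by rewrite lt_neqAle eq_sym n1 t1 lt_neqAle n3 t3.
have := section_length_concave h4 h34 pqr; lra.
Qed.

Lemma Rintegral_section (a : R) :
  mu.-integrable `]- h, h[ (EFin \o (fun t => cos (a * t) * section_length t)) /\
  \int[area]_(x in B) cos (a * x.1) = \int[mu]_(t in `]- h, h[) (cos (a * t) * section_length t).
Proof.
have Aoo : (area B < +oo)%E.
  apply: (@area_box_lty _ _ (h + M)) => // x Bx.
  by move: (Bh Bx) (BM Bx) (normr_ge0 x.1) (normr_ge0 x.2) => ? ? ? ?; split; lra.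
have mcos : measurable_fun setT (fun x : mR * mR => cos (a * x.1) : mR).
  have mc : measurable_fun setT (fun u : mR => cos (a * u) : mR).
    by apply: continuous_measurable_fun; exact: continuous_cos_scaled.
  exact: measurableT_comp mc measurable_fst.
pose F := (EFin \o (fun x : mR * mR => cos (a * x.1))) \_ B.
have iB : area.-integrable B (EFin \o (fun x => cos (a * x.1))).
  by apply: (@integrable_bounded _ _ _ 1) => // x _; exact: cos_max.
have iF : (mu \x mu)%E.-integrable setT F by apply/(integrable_mkcond _ mB).1.
have FE : fubini_F mu F = (EFin \o (fun t => cos (a * t) * section_length t)) \_ `]- h, h[.
  apply/funext => t; rewrite /fubini_F.
  have -> : (\int[mu]_y F (t, y) = (cos (a * t))%:E * mu (S t))%E.
    rewrite -integral_cst; last exact: measurable_xsection.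
    rewrite [RHS]integral_mkcond; apply: eq_integral => y _.
    rewrite /F !patchE /=; have -> : (y \in S t) = ((t, y) \in B) by rewrite /S mem_xsection.
    by case: ifP.
  rewrite patchE; case: ifPn => [|th].
    rewrite inE/= in_itv/= -ltr_norml => th.
    rewrite /section_length EFinM fineK// lebesgue_measure_interval//; last 2 first.
      by have [] := section_bounds th.
      by have [] := section_bounds th.
    exact: section_interval.
  suff -> : S t = set0 by rewrite measure0 mule0.
  apply/seteqP; split => // y /SE /Bh/= th'; move: th; rewrite notin_setE/= in_itv/= -ltr_norml.
  by rewrite th'.
have mh : measurable (`]- h, h[%classic : set mR) by exact: measurable_itv.
split.
  apply/(integrable_mkcond _ mh).2; rewrite -FE; exact: integrable_fubini_F.
rewrite /Rintegral; congr fine.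
rewrite integral_mkcond [RHS]integral_mkcond -FE.
exact/esym/integral12_prod_meas1.
Qed.

(** Slicing turns the integral into one of the section length, and replacing that length by [chord]
    can only increase it, up to zero. *)
Lemma Rintegral_cos_section_le0 : \int[area]_(x in B) cos (2 * pi / h * x.1) <= 0.
Proof.
have [iL ->] := Rintegral_section (2 * pi / h).
rewrite -(Rintegral_cos_affine_abs (section_length (h / 4)) D (h / 4) h0).
apply: le_Rintegral => //; first exact: integrable_cos_affine_abs.
by move=> t /=; rewrite in_itv/= -ltr_norml; exact: cos_section_length_le.
Qed.

End SectionLength.
End Sections.

(** * Sets with a point far from the origin *)

Section LongDirection.
Context {R : realType}.
Local Notation mR := (measurableTypeR R).
Local Notation area := (@area R).

Lemma convex_plane_rot c s (A : set (R * R)) : convex_plane A -> convex_plane (rot c s @^-1` A).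
Proof.
move=> cA x y t Ax Ay t01; have := cA _ _ _ Ax Ay t01.
by rewrite /rot /=; congr A; congr pair; ring.
Qed.

Lemma balanced_rot c s (A : set (R * R)) : balanced A -> balanced (rot c s @^-1` A).
Proof.
by move=> bA x /bA; rewrite /rot /=; congr A; congr pair; rewrite /=; ring.
Qed.

(* Rotate [x0] onto the first axis; with [h] the half-width along that axis, the
   frequency [2 * pi / h] works. *)
Lemma exists_cos_integral_le0 (A : set (R * R)) (M : R) (x0 : R * R) :
  measurable (A : set (mR * mR)) -> open A -> convex_plane A -> balanced A ->
  (forall x, A x -> `|x.1| <= M /\ `|x.2| <= M) -> A x0 -> 0 < enorm x0 ->
  exists2 xi, enorm xi <= 2 * pi / enorm x0 & \int[area]_(x in A) cos (dotp xi x) <= 0.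
Proof.
move=> mA oA cA bA AM Ax0 n0; set n := enorm x0.
pose c := x0.1 / n; pose s := x0.2 / n.
have nE : n ^+ 2 = x0.1 ^+ 2 + x0.2 ^+ 2 by rewrite sqr_sqrtr ?dotp_ge0// /dotp -!expr2.
have cs : c ^+ 2 + s ^+ 2 = 1.
  by rewrite /c /s !exprMn exprVn -mulrDl -nE divff// expf_neq0// gt_eqF.
have abs1 (u v : R) : u ^+ 2 + v ^+ 2 = 1 -> `|u| <= 1.
  by move=> uv; rewrite ler_norml; apply/andP; split; nra.
have c1 : `|c| <= 1 := abs1 _ _ cs.
have s1 : `|s| <= 1 by apply: (abs1 _ c); rewrite addrC.
pose B := rot c s @^-1` A.
have Bn : B (n, 0).
  rewrite /B /rot/= /c /s !mulr0 subr0 addr0 !divfK ?gt_eqF//.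
  by move: Ax0; rewrite [x in A x -> _]surjective_pairing.
have rotB x : `|x.1| <= `|(rot c s x).1| + `|(rot c s x).2| /\
    `|x.2| <= `|(rot c s x).1| + `|(rot c s x).2|.
  have e1 : x.1 = c * (rot c s x).1 + s * (rot c s x).2.
    by rewrite /rot/= -[LHS]mul1r -cs; ring.
  have e2 : x.2 = c * (rot c s x).2 - s * (rot c s x).1.
    by rewrite /rot/= -[LHS]mul1r -cs; ring.
  have le (u v w z : R) : `|u| <= 1 -> `|v| <= 1 -> `|u * w + v * z| <= `|w| + `|z|.
    move=> u1 v1; rewrite (le_trans (ler_normD _ _))// !normrM lerD// ler_piMl//.
  split; first by rewrite {1}e1; exact: le.
  by rewrite {1}e2 addrC -mulNr; apply: le => //; rewrite normrN.
have BM x : B x -> `|x.1| <= M + M /\ `|x.2| <= M + M.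
  move=> /AM[a1 a2]; have [b1 b2] := rotB x.
  by split; [apply: le_trans b1 _|apply: le_trans b2 _]; exact: lerD.
pose X := [set x.1 | x in B]; pose h := sup X.
have supX : has_sup X.
  split; first by exists n; exists (n, 0).
  by exists (M + M) => _ [x /BM[b1 _] <-]; apply: le_trans b1; exact: ler_norm.
have nh : n <= h by apply: ub_le_sup; [case: supX|exists (n, 0)].
have h0 : 0 < h by exact: lt_le_trans nh.
(* The supremum is not attained: by openness a point of [B] can be pushed a little along the first
   axis. *)
have Blt x : B x -> x.1 < h.
  move=> Bx; have [e /= e0 eA] := (nbhs_ballP _ _).1 (open_nbhs_nbhs (conj oA Bx)).
  have e2 : 0 < e / 2 by rewrite divr_gt0.
  have : B (x.1 + e / 2, x.2).
    apply: eA; rewrite /rot/=; split => /=; rewrite /ball/=.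
      have -> : c * x.1 - s * x.2 - (c * (x.1 + e / 2) - s * x.2) = - (c * (e / 2)) by ring.
      rewrite normrN normrM (gtr0_norm e2) (le_lt_trans (ler_piMl _ c1)) ?(ltW e2)//; lra.
    have -> : s * x.1 + c * x.2 - (s * (x.1 + e / 2) + c * x.2) = - (s * (e / 2)) by ring.
    rewrite normrN normrM (gtr0_norm e2) (le_lt_trans (ler_piMl _ s1)) ?(ltW e2)//; lra.
  move=> Bx'; have : x.1 + e / 2 <= h by apply: ub_le_sup; [case: supX|exists (x.1 + e / 2, x.2)].
  lra.
have bB : balanced B by exact: balanced_rot.
have Bh x : B x -> `|x.1| < h.
  by move=> Bx; rewrite ltr_norml (Blt _ Bx) andbT ltrNl; exact: (Blt _ (bB _ Bx)).
have Bsup t : t < h -> exists2 x, B x & t < x.1.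
  by move=> /(sup_gt supX.1)[_ [x Bx <-]] tx; exists x.
pose a := 2 * pi / h.
have a0 : 0 < a by rewrite divr_gt0// mulr_gt0// pi_gt0.
exists (a * c, a * s).
  rewrite /enorm; have -> : dotp (a * c, a * s) (a * c, a * s) = a ^+ 2.
    by rewrite /dotp/= -[RHS]mulr1 -cs; ring.
  rewrite sqrtr_sqr gtr0_norm// ler_wpM2l ?mulr_ge0 ?pi_ge0// lef_pV2 ?posrE//.
have Aoo : (area A < +oo)%E by apply: (@area_box_lty _ _ M).
rewrite -(@Rintegral_rot R c s A _ 1 cs mA Aoo (measurable_wave _ (@continuous_cos R))); last first.
  by move=> x; exact: cos_max.
have mB : measurable (B : set (mR * mR)) := measurable_preimage (@measurable_rot R c s) mA.
have := @Rintegral_cos_section_le0 R B (M + M) h mB (convex_plane_rot cA) bB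
  (fun x Bx => (BM x Bx).2) h0 Bh Bsup.
congr (_ <= 0); apply: eq_Rintegral => x _; congr cos.
by rewrite /dotp /rot/= -/a -[LHS]mulr1 -cs; ring.
Qed.

End LongDirection.

(** * Bessel polynomials, the round case, and the comparison with the disk *)

Section Assembly.
Context {R : realType}.
Local Notation mR := (measurableTypeR R).
Local Notation area := (@area R).

Lemma convex_plane_of_convex (A : set (R * R)) : convex A -> convex_plane A.
Proof.
move=> cA x y t Ax Ay /andP[t0 t1].
rewrite [X in (X, _)]addrC [X in (_, X)]addrC.
exact: set_mem (cA y x (Itv01 t0 t1) (mem_set Ay) (mem_set Ax)).
Qed.

(** The Taylor polynomial of cos (r * sqrt v) in the variable v, the form on which [circle_avg]
    acts. *)
Definition cos_poly n (r : R) : {poly R} := \sum_(k < n) ((-1) ^+ k * r ^+ (2 * k) / (2 * k)`!%:R) *: 'X^k.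

(* The Taylor polynomial in [v] of the primitive [2 * sqrt v / r * J_1 (r * sqrt v)] of
   [J_0 (r * sqrt v)]. *)
Definition bessel_poly n (r : R) : {poly R} :=
  \sum_(k < n) (bessel_coeff 1 k * (r ^+ 2 / 4) ^+ k) *: 'X^(k.+1).

Lemma horner_cos_poly n (r w : R) : (cos_poly n r).[w ^+ 2] = (cos_taylor n).[r * w].
Proof.
rewrite !horner_sum; apply: eq_bigr => k _.
by rewrite !hornerZ !hornerXn -exprM exprMn; ring.
Qed.

Lemma coef_circle_avg (p : {poly R}) k : (circle_avg p)`_k = p`_k * wallis k.
Proof.
rewrite /circle_avg -(poly_def _ (fun k => p`_k * wallis k)) coef_poly.
by case: ltnP => // pk; rewrite nth_default ?mul0r.
Qed.

Lemma circle_avgZ (e : R) (p : {poly R}) : circle_avg (e *: p) = e *: circle_avg p.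
Proof. by apply/polyP => k; rewrite coefZ !coef_circle_avg coefZ mulrA. Qed.

(** Both sides are 1 / (4 ^ k * k! ^ 2), the coefficient of J_0 up to sign. *)
Lemma wallis_fact k : wallis k / (2 * k)`!%:R = k.+1%:R * bessel_coeff 1 k * (-1) ^+ k / 4 ^+ k :> R.
Proof.
elim: k => [|k ih].
  by rewrite /wallis big_ord0 muln0 bessel_coeff0 fact0 !expr0 (_ : 1`! = 1%N)//; field.
rewrite /wallis big_ord_recr/= -/(wallis k) mulnS !factS !natrM bessel_coeffS addn1.
have f0 := @fact_neq0 R (2 * k).
have -> : (wallis k : R) = (2 * k)`!%:R * (k.+1%:R * bessel_coeff 1 k * (-1) ^+ k / 4 ^+ k).
  by rewrite -ih mulrC divfK.
have -> : k.+2%:R = k%:R + 2 :> R by rewrite -addn2 natrD.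
have -> : k.+1%:R = k%:R + 1 :> R by rewrite -addn1 natrD.
have -> : (2 * k).+2%:R = 2 * k%:R + 2 :> R by rewrite -addn2 natrD natrM.
have -> : (2 * k).+1%:R = 2 * k%:R + 1 :> R by rewrite -addn1 natrD natrM.
have k0 : 0 <= k%:R :> R by [].
have e4 : 4 ^+ k != 0 :> R by rewrite expf_neq0.
rewrite !exprS; field; rewrite e4 f0/=.
by apply/and4P; split; apply: lt0r_neq0; lra.
Qed.

(** Truncated form of two facts: J_0 is the circle average of the cosine, and (s * J_1 s)' = s * J_0
    s. *)
Lemma deriv_bessel_poly n (r : R) : (bessel_poly n r)^`() = circle_avg (cos_poly n r).
Proof.
apply/polyP => k; rewrite coef_circle_avg.
rewrite coef_deriv /cos_poly -(poly_def n (fun k => (-1) ^+ k * r ^+ (2 * k) / (2 * k)`!%:R)).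
rewrite /bessel_poly; under eq_bigr do rewrite ['X^_]exprSr scalerAl.
rewrite -mulr_suml -(poly_def n (fun k => bessel_coeff 1 k * (r ^+ 2 / 4) ^+ k)).
rewrite coefMX/= !coef_poly.
case: ltnP => kn; last by rewrite mul0r mul0rn.
transitivity ((-1) ^+ k * r ^+ (2 * k) * (wallis k / (2 * k)`!%:R)); last by ring.
rewrite wallis_fact expr_div_n -exprM.
have s1 : (-1) ^+ k * (-1) ^+ k = 1 :> R by rewrite -exprMn mulrNN mul1r expr1n.
transitivity (bessel_coeff 1 k * (r ^+ (2 * k) / 4 ^+ k) * k.+1%:R * ((-1) ^+ k * (-1) ^+ k)).
  by rewrite s1 mulr1 mulr_natr.
by ring.
Qed.

Lemma horner_bessel_poly0 n r : (bessel_poly n r).[0] = 0.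
Proof.
by rewrite horner_sum big1// => k _; rewrite hornerZ hornerXn expr0n mulr0.
Qed.

Lemma horner_bessel_poly n (r v : R) : r ^+ 2 / 4 * (bessel_poly n r).[v] =
  \sum_(k < n) bessel_coeff 1 k * (r ^+ 2 / 4 * v) ^+ k.+1.
Proof.
rewrite /bessel_poly; move: (r ^+ 2 / 4) => q; rewrite horner_sum mulr_sumr; apply: eq_bigr => k _.
by rewrite hornerZ hornerXn exprMn (exprS q); ring.
Qed.

Lemma cos_scaled_le n (r w : R) : ~~ odd n -> cos (r * w) <= (cos_poly n.+1 r).[w ^+ 2].
Proof.
move=> no; have := cos_alternate n (r * w); rewrite horner_cos_poly -signr_odd/= no expr1.
lra.
Qed.

Lemma cos_scaled_ge n (r w : R) : odd n -> (cos_poly n.+1 r).[w ^+ 2] <= cos (r * w).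
Proof.
move=> no; have := cos_alternate n (r * w); rewrite horner_cos_poly -signr_odd/= no expr0.
lra.
Qed.

(** The bound [40 / 11] lies between (3.81 / 2) ^ 2 = 3.629 and (j_{1,1} / 2) ^ 2 = 3.670; the sum
    approximates J_1 (2 * sqrt v) / sqrt v from below. *)
Lemma bessel_taylor1_ge (v : R) : 0 <= v <= 40 / 11 ->
  1 / 10 ^+ 3 <= \sum_(k < 8) bessel_coeff 1 k * v ^+ k.
Proof.
move=> vV; rewrite !big_ord_recr big_ord0/= !bessel_coeffS bessel_coeff0 (_ : 1`! = 1%N)// !addn1.
have B i j : 0 <= (11 * v - 0) ^+ i * (40 - 11 * v) ^+ j.
  by apply: bernstein_ge0; move: vV => /andP[? ?]; apply/andP; lra.
have := B 0%N 7%N; have := B 1%N 6%N; have := B 2%N 5%N; have := B 3%N 4%N.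
have := B 4%N 3%N; have := B 5%N 2%N; have := B 6%N 1%N; have := B 7%N 0%N.
clear B vV; rewrite !expr0; lra.
Qed.

Lemma sqdiskE r : 0 < r -> disk r = sqdisk (r ^+ 2) :> set (R * R).
Proof.
move=> r0; apply/seteqP; split => x; rewrite /disk /sqdisk /enorm/= => xr.
  by rewrite -(sqr_sqrtr (dotp_ge0 x)) ltr_pXn2r ?nnegrE ?sqrtr_ge0// ltW.
by rewrite -(@ltr_pXn2r _ 2) ?nnegrE ?sqrtr_ge0 ?ltW// sqr_sqrtr ?dotp_ge0.
Qed.

(** By rotation invariance the integral [K] is the same in all directions, so the average bound for
    minus the cosine, with [c = 0], reads [- K <= - area D / 1000]. *)
Lemma cos_integral_sqdisk_gt0 (r : R) xi : 0 < r -> enorm xi * r < 381 / 100 ->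
  0 < \int[area]_(x in sqdisk (r ^+ 2)) cos (dotp xi x).
Proof.
move=> r0 xir; set D := sqdisk _; set e := enorm xi in xir *.
have mD : measurable (D : set (mR * mR)) by exact: measurable_sqdisk.
have Doo : (area D < +oo)%E by rewrite -ge0_fin_numE// area_sqdisk_fin.
have [e0|en0] := eqVneq e 0.
- have xi0 : xi = (0, 0).
    move: e0; rewrite /e /enorm /dotp => /eqP; rewrite sqrtr_eq0 => h.
    by rewrite [LHS]surjective_pairing; congr pair; nra.
  rewrite (_ : \int[area]_(x in D) cos (dotp xi x) = fine (area D)); last first.
    rewrite /Rintegral (eq_integral (cst 1%E)); first by rewrite integral_cst//= mul1e.
    by move=> x _; rewrite xi0 /dotp/= !mul0r addr0 cos0.
  rewrite area_sqdiskM ?sqr_ge0// fineM//; last exact: area_sqdisk_fin.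
  by rewrite mulr_gt0 ?exprn_gt0//; exact: area_sqdisk1_gt0.
have e0 : 0 < e by rewrite lt_neqAle eq_sym en0 sqrtr_ge0.
set K := \int[area]_(x in D) cos (dotp xi x).
pose c0 := xi.1 / e; pose s0 := xi.2 / e.
have cs0 : c0 ^+ 2 + s0 ^+ 2 = 1.
  rewrite /c0 /s0 !expr_div_n -mulrDl sqr_sqrtr ?dotp_ge0// {1}/dotp -!expr2 divff//.
  by rewrite -/(dotp xi xi) -[dotp xi xi]sqr_sqrtr ?dotp_ge0// expf_neq0.
have rotK t : \int[area]_(x in D) - cos (e * dotp (dir t) x) = - K.
  (* Cosine and sine of the angle from [dir t] to [xi]. *)
  pose c := c0 * cos t + s0 * sin t; pose s := s0 * cos t - c0 * sin t.
  have cs : c ^+ 2 + s ^+ 2 = 1.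
    transitivity ((c0 ^+ 2 + s0 ^+ 2) * (cos t ^+ 2 + sin t ^+ 2)); first by rewrite /c /s; ring.
    by rewrite cs0 cos2Dsin2 mulr1.
  have DE : rot c s @^-1` D = D.
    apply/seteqP; split => x; rewrite /D /sqdisk /rot /dotp /=;
    rewrite (_ : _ + (s * x.1 + c * x.2) * _ = (c ^+ 2 + s ^+ 2) * (x.1 * x.1 + x.2 * x.2)); try ring;
    by rewrite cs mul1r.
  have := @Rintegral_rot _ c s D (fun x => cos (dotp xi x)) 1 cs mD Doo
    (measurable_wave xi (@continuous_cos R)) (fun x => cos_max _).
  rewrite DE -/K => <-.
  have cE : c0 * c + s0 * s = cos t.
    by transitivity ((c0 ^+ 2 + s0 ^+ 2) * cos t); [rewrite /c /s; ring|rewrite cs0 mul1r].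
  have sE : s0 * c - c0 * s = sin t.
    by transitivity ((c0 ^+ 2 + s0 ^+ 2) * sin t); [rewrite /c /s; ring|rewrite cs0 mul1r].
  have wE x : e * dotp (dir t) x = dotp xi (rot c s x).
    rewrite /dotp /dir /rot/= -cE -sE /c0 /s0; by field.
  under eq_Rintegral do rewrite wE -mulN1r.
  rewrite RintegralZl ?mulN1r//; apply: (@integrable_bounded _ _ _ 1) => //.
    exact: measurableT_comp (measurable_wave xi (@continuous_cos R)) (@measurable_rot R c s).
  by move=> x _; exact: cos_max.
have := @circle_average_le R D (fun w => - cos (e * w)) (-1 *: cos_poly 8 e) (-1 *: bessel_poly 8 e)
  (r ^+ 2) (1 / 10 ^+ 3) 0 (- K) mD (@star_shaped_sqdisk R _) (sqr_ge0 r) (fun x => @ltW _ _ _ _).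
have cf : continuous (fun w => - cos (e * w)).
  by move=> w; apply: cvgN; exact: continuous_cos_scaled.
move=> /(_ _ (lexx 0) cf) H.
suff : - K <= 1 / 10 ^+ 3 * (0 * fine (area (sqdisk 1)) - fine (area D)).
  have : 0 < fine (area D).
    rewrite area_sqdiskM ?sqr_ge0// fineM//; last exact: area_sqdisk_fin.
    by rewrite mulr_gt0 ?exprn_gt0//; exact: area_sqdisk1_gt0.
  by rewrite mul0r sub0r mulrN lerN2 => D0; apply: lt_le_trans; rewrite mulr_gt0// divr_gt0// exprn_gt0.
apply: H => //.
- by move=> w; rewrite normrN; exact: cos_max.
- by move=> w; rewrite scaleN1r hornerN lerN2; exact: cos_scaled_ge.
- by rewrite hornerZ horner_bessel_poly0 mulr0.
- by rewrite derivZ deriv_bessel_poly circle_avgZ.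
- move=> v /andP[v0 vr]; rewrite hornerZ mulN1r sub0r mulrN lerN2.
  pose q := e ^+ 2 / 4; have q0 : 0 < q by rewrite divr_gt0// exprn_gt0.
  have qv : 0 <= q * v <= 40 / 11.
    rewrite mulr_ge0 ?(ltW q0)//=; apply: (@le_trans _ _ (q * r ^+ 2)); first by rewrite ler_pM2l.
    rewrite /q mulrAC -exprMn ler_pdivrMr//.
    have : (e * r) ^+ 2 <= (381 / 100) ^+ 2.
      by apply: lerXn2r; [rewrite nnegrE mulr_ge0// ltW|rewrite nnegrE; lra|exact: ltW].
    by move/le_trans; apply; lra.
  rewrite -(ler_pM2l q0) horner_bessel_poly -/q.
  under eq_bigr do rewrite exprS mulrCA.
  rewrite -mulr_sumr [leLHS]mulrCA mulrC.
  apply: ler_wpM2l; first by case/andP: qv.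
  exact: bessel_taylor1_ge.
- by move=> t; rewrite rotK.
Qed.

(* The constant 478 / 100 is chosen below [C * (381 / 100)] and above
   [sqrt (2284 / 100)]: the disk of squared radius [2284 / 100 / q ^ 2] then has
   smaller area than [A], which contradicts positivity in all directions. *)
Lemma exists_cos_integral_round_le0 (A : set (R * R)) (r : R) :
  measurable (A : set (mR * mR)) -> star_shaped A -> 0 < r ->
  area A = area (sqdisk (r ^+ 2)) -> (forall x, A x -> 478 / 100 / r * enorm x < 2 * pi) ->
  exists2 xi, enorm xi <= 478 / 100 / r & \int[area]_(x in A) cos (dotp xi x) <= 0.
Proof.
move=> mA sA r0 Ar; move qE : (478 / 100 / r) => q Apos.
have q0 : 0 < q by rewrite -qE; apply: divr_gt0; [lra|exact: r0].
have enorm_dir t : enorm (q * cos t, q * sin t) = q.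
  rewrite /enorm /dotp/= (_ : _ + _ = q ^+ 2 * (cos t ^+ 2 + sin t ^+ 2)); last by ring.
  by rewrite cos2Dsin2 mulr1 sqrtr_sqr gtr0_norm.
apply: contrapT => pos.
have {}pos t : 0 <= \int[area]_(x in A) cos (q * dotp (dir t) x).
  rewrite leNgt; apply/negP => neg; apply: pos; exists (q * cos t, q * sin t).
    by rewrite enorm_dir.
  apply: ltW; move: neg; congr (_ < _); apply: eq_Rintegral => x _; congr cos.
  by rewrite /dotp /dir/=; ring.
pose k := q ^+ 2 / 4; have k0 : 0 < k by rewrite divr_gt0// exprn_gt0.
have AV x : A x -> dotp x x <= (22 / 7) ^+ 2 / k.
  move=> /Apos qx; rewrite ler_pdivlMr// -(sqr_sqrtr (dotp_ge0 x)) -/(enorm x) /k.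
  have e0 : 0 <= enorm x by exact: sqrtr_ge0.
  have p0 := pi_gt0 R; have p1 := @pi_lt22_7 R.
  have h : (q * enorm x) ^+ 2 <= (2 * (22 / 7)) ^+ 2.
    apply: lerXn2r; rewrite ?nnegrE; [exact: mulr_ge0 (ltW q0) e0|lra|].
    by apply: le_trans (ltW qx) _; lra.
  by move: h; rewrite !exprMn; lra.
have V0 : 0 <= (22 / 7) ^+ 2 / k :> R by rewrite divr_ge0 ?sqr_ge0 ?ltW.
(* Nine terms put the Taylor polynomial above the cosine. The constants are those of
   [bessel_primitive_le_affine], halved and rescaled by [k]; [22 / 7] stands for pi. *)
have := @circle_average_le R A (fun w => cos (q * w)) (cos_poly 9 q) (bessel_poly 9 q)
  ((22 / 7) ^+ 2 / k) (156 / 10 ^+ 3) (571 / 100 / k) 0 mA sA V0 AV.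
move=> /(_ _ _ (@continuous_cos_scaled R q)) H.
suff : 0 <= 156 / 10 ^+ 3 * (571 / 100 / k * fine (area (sqdisk 1)) - fine (area A)).
  have P0 := @area_sqdisk1_gt0 R.
  rewrite Ar (area_sqdiskM (sqr_ge0 r)) fineM ?area_sqdisk_fin// -mulrBl mulrA.
  rewrite (pmulr_lge0 _ P0) pmulr_rge0; last by lra.
  rewrite subr_ge0 ler_pdivlMr// /k -qE.
  have -> : r ^+ 2 * ((478 / 100 / r) ^+ 2 / 4) = (478 / 100) ^+ 2 / 4.
    by field; rewrite gt_eqF.
  by lra.
apply: H.
- by lra.
- by apply: divr_ge0 (ltW k0); lra.
- by move=> w; exact: cos_max.
- by move=> w; exact: cos_scaled_le.
- exact: horner_bessel_poly0.
- exact: deriv_bessel_poly.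
- move=> v /andP[v0 vV].
  have kv : 0 <= k * v <= (22 / 7) ^+ 2.
    by rewrite (mulr_ge0 (ltW k0) v0)/= mulrC -ler_pdivlMr.
  rewrite -(ler_pM2l k0) horner_bessel_poly -/k.
  have -> : k * (156 / 10 ^+ 3 * (571 / 100 / k - v)) = 156 / 10 ^+ 3 * (571 / 100 - k * v).
    by field; rewrite gt_eqF.
  have := bessel_primitive_le_affine kv; move: (k * v) => z.
  rewrite !big_ord_recr big_ord0/= !bessel_coeffS bessel_coeff0 (_ : 1`! = 1%N)// !addn1.
  by clear; lra.
- exact: pos.
Qed.

Lemma kappa_disk_ge (r : R) : 0 < r -> ((381 / 100 / r)%:E <= kappa (disk r))%E.
Proof.
move=> r0; apply: le_ereal_inf_tmp => _ [xi xi0 <-]; rewrite lee_fin ler_pdivrMr// leNgt.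
apply/negP => /(cos_integral_sqdisk_gt0 r0); rewrite -sqdiskE// => pos.
by have := congr1 (@complex.Re R) xi0; rewrite /= => e; rewrite e ltxx in pos.
Qed.

Lemma area_symm_disk (A : set (R * R)) : (area A < +oo)%E -> (0 < area A)%E ->
  exists r, [/\ 0 < r, symm_disk A = disk r & area A = area (sqdisk (r ^+ 2))].
Proof.
move=> Aoo A0; have Afin : area A \is a fin_num by rewrite ge0_fin_numE.
pose S := [set r | area (disk r) = area A].
have P0 := @area_sqdisk1_gt0 R.
have SN : S !=set0.
  have a0 : 0 < fine (area A) / fine (area (sqdisk 1)).
    by apply: (divr_gt0 _ P0); apply: fine_gt0; rewrite A0.
  (* Existence of a radius is what gives [get] its specification; this one comes from linearity of
     the area in the squared radius. *)
  exists (Num.sqrt (fine (area A) / fine (area (sqdisk 1)))).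
  rewrite -[S _]/(area (disk _) = area A) sqdiskE ?sqrtr_gt0; last exact: a0.
  rewrite (sqr_sqrtr (ltW a0)) (area_sqdiskM (ltW a0)).
  by rewrite -{2}(fineK (area_sqdisk_fin 1)) -EFinM divfK ?gt_eqF// fineK.
have Sg : area (disk (get S)) = area A by exact: getPex SN.
exists (get S); have g0 : 0 < get S.
  rewrite ltNge; apply/negP => g0; move: A0; rewrite -Sg (_ : disk _ = set0) ?measure0 ?ltxx//.
  by apply/seteqP; split => // x; rewrite /disk/= ltNge (le_trans g0)// sqrtr_ge0.
split; [exact: g0|by []|rewrite -sqdiskE; [exact: esym Sg|exact: g0]].
Qed.

Lemma area_open_gt0 (A : set (R * R)) : open A -> A (0, 0) -> (0 < area A)%E.
Proof.
move=> oA A0; have /nbhs_ballP[e /= e0 eA] : nbhs ((0, 0) : R * R) A by apply: open_nbhs_nbhs.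
apply: (@lt_le_trans _ _ (area (sqdisk (e ^+ 2)))).
  rewrite area_sqdiskM ?sqr_ge0// mule_gt0// ?lte_fin ?exprn_gt0//.
  by rewrite -(fineK (area_sqdisk_fin 1)) lte_fin area_sqdisk1_gt0.
apply: le_measure; rewrite ?inE; [exact: measurable_sqdisk|exact: open_measurable_prod|].
have bnd (y z : R) : y * y + z * z < e ^+ 2 -> `|y| < e.
  by move=> yz; rewrite -ltr_sqr ?nnegrE ?(ltW e0)// real_normK ?num_real//; have := sqr_ge0 z; lra.
move=> x; rewrite /sqdisk /dotp/= => xe; apply: eA; split.
  by rewrite -ball_normE/= sub0r normrN; exact: bnd xe.
by rewrite -ball_normE/= sub0r normrN; apply: (bnd _ x.1); rewrite addrC.
Qed.

Lemma bounded_set_box (A : set (R * R)) : bounded_set A ->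
  exists M, forall x, A x -> `|x.1| <= M /\ `|x.2| <= M.
Proof.
move=> [M [_ bM]]; exists (M + 1) => x Ax.
have : `|x| <= M + 1 by apply: (bM (M + 1)) => //; rewrite ltrDl.
by rewrite prod_normE/= ge_max => /andP.
Qed.

Lemma kappa_ge0 (A : set (R * R)) : (0 <= kappa A)%E.
Proof. by apply: le_ereal_inf_tmp => _ [xi _ <-]; rewrite lee_fin sqrtr_ge0. Qed.

(** For the empty set the transform vanishes even at the frequency 0, so this case is settled
    apart. *)
Lemma kappa_set0 : (kappa (set0 : set (R * R)) <= 0)%E.
Proof.
apply: ereal_inf_lbound; exists (0, 0); last by rewrite /enorm /dotp/= mul0r addr0 sqrtr0.
by rewrite /real_null_set /fourier_ind/= !Rintegral_set0.
Qed.

(** The threshold lies below 2 * j_{0,1} / j_{1,1} and still satisfies 1.2551 * 3.81 = 4.7819 >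
    4.78. *)
Lemma kappa_le_ratio (A : set (R * R)) (C : R) : 12551 / 10 ^+ 4 <= C ->
  bounded_set A -> open A -> convex A -> balanced A -> (kappa A <= C%:E * kappa (symm_disk A))%E.
Proof.
move=> Cge bdA oA /convex_plane_of_convex cA bA.
have C0 : 0 < C by apply: lt_le_trans Cge; lra.
have [->|/set0P[y Ay]] := eqVneq A set0.
  by apply: le_trans kappa_set0 _; rewrite mule_ge0 ?kappa_ge0// lee_fin ltW.
have mA := open_measurable_prod oA.
have [M AM] := bounded_set_box bdA; have Aoo := area_box_lty mA AM.
have sA := convex_balanced_star cA bA.
have A00 : A (0, 0) by have := sA y 0 Ay; rewrite normr0 !mul0r; apply.
have [r [r0 -> Ar]] := area_symm_disk Aoo (area_open_gt0 oA A00).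
have [xi xi_le cos_le] : exists2 xi, enorm xi <= 478 / 100 / r &
    \int[area]_(x in A) cos (dotp xi x) <= 0.
  have [[x0 Ax0 x0_far]|near] := pselect (exists2 x0, A x0 & 2 * pi <= 478 / 100 / r * enorm x0).
    have n0 : 0 < enorm x0.
      rewrite lt_neqAle sqrtr_ge0 andbT; apply/eqP => e; move: x0_far.
      by rewrite -e mulr0 leNgt mulr_gt0// pi_gt0.
    have [xi xi_le cos_le] := exists_cos_integral_le0 mA oA cA bA AM Ax0 n0.
    by exists xi => //; apply: le_trans xi_le _; rewrite ler_pdivrMr.
  apply: exists_cos_integral_round_le0 => // x Ax; rewrite ltNge; apply/negP => x_far.
  by apply: near; exists x.
apply: le_trans (kappa_le mA Aoo bA cos_le) _.
apply: (@le_trans _ _ (C%:E * (381 / 100 / r)%:E)%E); last first.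
  by rewrite lee_pmul2l ?lte_fin//; exact: kappa_disk_ge.
rewrite -EFinM lee_fin; apply: le_trans xi_le _.
by rewrite mulrA ler_pM2r ?invr_gt0//; lra.
Qed.

End Assembly.

Theorem theorem2p4 (R : realType) :
  let C : R := 2 * bessel_zero 0 1 / bessel_zero 1 1 in
  (forall Omega : set (R * R),
     bounded_set Omega -> open Omega -> convex Omega -> balanced Omega ->
     (kappa Omega <= C%:E * kappa (symm_disk Omega))%E) /\
  `|C - (1 + 2552 / 10 ^+ 4)| < 1 / (2 * 10 ^+ 4).
Proof.
move=> C; have C_approx := bessel_zero_ratio_bounds R; split; last exact: C_approx.
move=> A bdA oA cA bA; apply: kappa_le_ratio => //.
by move: C_approx; rewrite -/C ltr_norml => /andP[+ _]; lra.
Qed.
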